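(* Let $\mathcal{C}$ be a $k$-linear Hom-finite Krull-Schmidt exact category, and let $C$ and $Y$ be two objects of $\mathcal{C}$. Assume that $C\in\mathcal{C}_r$ and that $H$ is a left $\Gamma_C$-submodule of $\operatorname{Hom}_{\mathcal{C}}(C,Y)$ satisfying $\mathcal{P}(C,Y)\subseteq H$. Then there exists some deflation $\alpha\colon X\to Y$ which is right $C$-determined and such that $\operatorname{Ker}\alpha\in\operatorname{add}(\tau C)$ and $H=\operatorname{Im}\operatorname{Hom}_{\mathcal{C}}(C,\alpha)$.
   Context: Setting. $k$ is a commutative artinian ring, $\check k$ is its minimal injective cogenerator and $D=\operatorname{Hom}_k(-,\check k)$. $\mathcal{C}$ is a skeletally small, $k$-linear, Hom-finite (each $\operatorname{Hom}_{\mathcal{C}}(X,Y)$ is a finitely generated $k$-module), Krull-Schmidt (each object is a finite direct sum of objects with local endomorphism rings) exact category in the sense of Quillen: an additive category with a chosen class of kernel-cokernel pairs $X\xrightarrow{i}E\xrightarrow{d}Y$, called conflations, satisfying the usual axioms; $i$ is called an inflation and $d$ a deflation. $\operatorname{Ext}^1_{\mathcal{C}}(Y,X)$ is the $k$-module of equivalence classes of conflations $X\to E\to Y$. Trivial morphisms. A morphism $f\colon X\to Y$ is projectively trivial if for every $Z$ the map $\operatorname{Ext}^1_{\mathcal{C}}(f,Z)\colon\operatorname{Ext}^1_{\mathcal{C}}(Y,Z)\to\operatorname{Ext}^1_{\mathcal{C}}(X,Z)$ is zero; $\mathcal{P}(X,Y)$ is the set of such morphisms. It is injectively trivial if for every $Z$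 the map $\operatorname{Ext}^1_{\mathcal{C}}(Z,f)\colon\operatorname{Ext}^1_{\mathcal{C}}(Z,X)\to\operatorname{Ext}^1_{\mathcal{C}}(Z,Y)$ is zero; $\mathcal{I}(X,Y)$ is the set of such morphisms. $\mathcal{P}$ and $\mathcal{I}$ are ideals; $\underline{\mathcal{C}}=\mathcal{C}/\mathcal{P}$ and $\overline{\mathcal{C}}=\mathcal{C}/\mathcal{I}$, with morphism modules $\underline{\operatorname{Hom}}_{\mathcal{C}}$ and $\overline{\operatorname{Hom}}_{\mathcal{C}}$. $\mathcal{C}_r$ and $\tau$. $\mathcal{C}_r$ is the full subcategory of objects $X$ such that the functor $D\operatorname{Ext}^1_{\mathcal{C}}(X,-)\colon\overline{\mathcal{C}}\to k\text{-mod}$ is representable; $\mathcal{C}_l$ is the full subcategory of objects $X$ such that the functor $D\operatorname{Ext}^1_{\mathcal{C}}(-,X)\colon\underline{\mathcal{C}}\to k\text{-mod}$ is representable. For $X\in\mathcal{C}_r$, $\tau X$ denotes an object (determined up to isomorphism in $\overline{\mathcal{C}}$) with a natural isomorphism $\overline{\operatorname{Hom}}_{\mathcal{C}}(-,\tau X)\simeq D\operatorname{Ext}^1_{\mathcal{C}}(X,-)$; for $X\in\mathcal{C}_l$, $\tau^-X$ denotes an object (determined up to isomorphism in $\underline{\mathcal{C}}$) with a natural isomorphism $\underline{\operatorname{Hom}}_{\mathcal{C}}(\tau^-X,-)\simeq D\operatorname{Ext}^1_{\mathcal{C}}(-,X)$. It is known (and part of the setup) that $\tau$ and $\tau^-$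 give mutually quasi-inverse equivalences $\underline{\mathcal{C}_r}\to\overline{\mathcal{C}_l}$ and $\overline{\mathcal{C}_l}\to\underline{\mathcal{C}_r}$ between the images of $\mathcal{C}_r$ in $\underline{\mathcal{C}}$ and of $\mathcal{C}_l$ in $\overline{\mathcal{C}}$. Notation. $\Gamma_C=\operatorname{End}_{\mathcal{C}}(C)^{\mathrm{op}}$; $\operatorname{Hom}_{\mathcal{C}}(C,Y)$ is a left $\Gamma_C$-module via precomposition. $\operatorname{add}M$ is the category of direct summands of finite direct sums of copies of $M$. $\operatorname{Im}\operatorname{Hom}_{\mathcal{C}}(C,\alpha)$ is the image of $\operatorname{Hom}_{\mathcal{C}}(C,X)\to\operatorname{Hom}_{\mathcal{C}}(C,Y)$, $s\mapsto\alpha\circ s$. Determined morphisms. A morphism $f\colon X\to Y$ is right $C$-determined if each $g\colon T\to Y$ factors through $f$ (i.e. $g=f\circ t$ for some $t\colon T\to X$), provided that for each $h\colon C\to T$ the morphism $g\circ h$ factors through $f$. *)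

(* Defs.v *)
From HB Require Import structures.
From mathcomp Require Import all_boot all_algebra.
From mathcomp Require Import boolp.

Set Implicit Arguments.
Unset Strict Implicit.
Unset Printing Implicit Defensive.

Import GRing.Theory.
Local Open Scope ring_scope.

Declare Scope cat_scope.
Delimit Scope cat_scope with C.
Local Open Scope cat_scope.

Definition artinian (R : pzRingType) : Prop :=
  forall I : nat -> submodClosed R^o,
    (forall n, {subset I n.+1 <= I n}) ->
    exists n, forall m, (n <= m)%N -> I m =i I n.

Definition finitely_generated (R : pzRingType) (M : lmodType R) : Prop :=
  exists n (v : 'I_n -> M), forall x, exists a : 'I_n -> R,
    x = \sum_i a i *: v i.

Definition injective_module (R : pzRingType) (E : lmodType R) : Prop :=
  forall (M N : lmodType R) (i : {linear M -> N}) (f : {linear M -> E}),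
    injective i -> exists g : {linear N -> E}, forall x, g (i x) = f x.

Definition cogenerator (R : pzRingType) (E : lmodType R) : Prop :=
  forall (M : lmodType R) (x : M), x != 0 ->
    exists f : {linear M -> E}, f x != 0.

(* Over an artinian commutative ring this pins E down up to isomorphism as the
   direct sum of the injective envelopes of the simple modules. *)
Definition minimal_injective_cogenerator (R : pzRingType) (E : lmodType R) :
    Prop :=
  [/\ injective_module E, cogenerator E
    & forall E' : lmodType R, injective_module E' -> cogenerator E' ->
        exists f : {linear E -> E'}, injective f].

Definition invertible (R : pzRingType) (x : R) : Prop :=
  exists y, x * y = 1 /\ y * x = 1.

(* Noncommutative rings: local means that the non-invertible elements are closed
   under addition in a nonzero ring. *)
Definition local_ring (R : pzRingType) : Prop :=
  (1 : R) <> 0 /\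
  forall x y : R, ~ invertible x -> ~ invertible y -> ~ invertible (x + y).

Section HomModule.
Context (k : comPzRingType) (E M : lmodType k).

Record hom_mod : Type := HomMod { hom_fun : {linear M -> E} }.

HB.instance Definition _ := gen_eqMixin hom_mod.
HB.instance Definition _ := gen_choiceMixin hom_mod.

Definition hom_mod_apply (phi : hom_mod) : M -> E := hom_fun phi.
Coercion hom_mod_apply : hom_mod >-> Funclass.

Lemma hom_modP (phi psi : hom_mod) : (forall x, phi x = psi x) -> phi = psi.
Proof.
case: phi => -[f cf]; case: psi => -[g cg] /= e.
have efg : f = g by apply/funext.
clear e; subst g; congr (HomMod (GRing.Linear.Pack _)).
case: cf cg => [[a1] [a2]] [[b1] [b2]].
by rewrite (Prop_irrelevance a1 b1) (Prop_irrelevance a2 b2).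
Qed.

Lemma hom_modPl (phi : hom_mod) a x y : phi (a *: x + y) = a *: phi x + phi y.
Proof. exact: (linearP (hom_fun phi)). Qed.

Definition mk_hom (f : M -> E) (lf : linear f) : hom_mod :=
  HomMod (HB.pack_for {linear M -> E} f (GRing.isLinear.Build k M E *:%R f lf)).

Fact hom_zero_subproof : linear (fun _ : M => 0 : E).
Proof. by move=> a x y; rewrite scaler0 addr0. Qed.
Fact hom_opp_subproof (phi : hom_mod) : linear (fun x => - phi x).
Proof. by move=> a x y; rewrite hom_modPl opprD scalerN. Qed.
Fact hom_add_subproof (phi psi : hom_mod) : linear (fun x => phi x + psi x).
Proof. by move=> a x y; rewrite !hom_modPl scalerDr addrACA. Qed.
Fact hom_scale_subproof b (phi : hom_mod) : linear (fun x => b *: phi x).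
Proof. by move=> a x y; rewrite !hom_modPl scalerDr !scalerA mulrC. Qed.

Definition hom_zero := mk_hom hom_zero_subproof.
Definition hom_opp phi := mk_hom (hom_opp_subproof phi).
Definition hom_add phi psi := mk_hom (hom_add_subproof phi psi).
Definition hom_scale b phi := mk_hom (hom_scale_subproof b phi).

Fact hom_addA : associative hom_add.
Proof. by move=> f g h; apply: hom_modP => x; apply: addrA. Qed.
Fact hom_addC : commutative hom_add.
Proof. by move=> f g; apply: hom_modP => x; apply: addrC. Qed.
Fact hom_add0 : left_id hom_zero hom_add.
Proof. by move=> f; apply: hom_modP => x; apply: add0r. Qed.
Fact hom_addN : left_inverse hom_zero hom_opp hom_add.
Proof. by move=> f; apply: hom_modP => x; apply: addNr. Qed.
HB.instance Definition _ :=
  GRing.isZmodule.Build hom_mod hom_addA hom_addC hom_add0 hom_addN.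

Fact hom_scaleA a b phi : hom_scale a (hom_scale b phi) = hom_scale (a * b) phi.
Proof. by apply: hom_modP => x; apply: scalerA. Qed.
Fact hom_scale1 : left_id 1 hom_scale.
Proof. by move=> f; apply: hom_modP => x; apply: scale1r. Qed.
Fact hom_scaleDr : right_distributive hom_scale +%R.
Proof. by move=> a f g; apply: hom_modP => x; apply: scalerDr. Qed.
Fact hom_scaleDl phi : {morph hom_scale^~ phi : a b / a + b}.
Proof. by move=> a b; apply: hom_modP => x; apply: scalerDl. Qed.
HB.instance Definition _ := GRing.Zmodule_isLmodule.Build k hom_mod
  hom_scaleA hom_scale1 hom_scaleDr hom_scaleDl.

End HomModule.

Section QuotientModule.
Context (R : pzRingType) (M : lmodType R) (S : submodClosed M).

Definition submod_pred : {pred M} := fun x => x \in S.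

Fact submod_pred_closed : zmod_closed submod_pred.
Proof. exact: (GRing.submod_closedB (submodClosedP S)). Qed.
HB.instance Definition _ :=
  GRing.isZmodClosed.Build M submod_pred submod_pred_closed.

Definition quot_mod : Type := Quotient.quot submod_pred.
HB.instance Definition _ := GRing.Zmodule.on quot_mod.

Definition quot_pi : M -> quot_mod := \pi_(Quotient.quot submod_pred)%qT.

Lemma quot_pi_eq x y : quot_pi x = quot_pi y <-> x - y \in S.
Proof.
split=> [/eqP e|e].
  by move: e; rewrite /quot_pi -Quotient.idealrBE.
by apply/eqP; rewrite /quot_pi -Quotient.idealrBE.
Qed.

Lemma quot_pi_surj (u : quot_mod) : exists x, quot_pi x = u.
Proof. by exists (repr u); apply: reprK. Qed.

Lemma quot_piD x y : quot_pi (x + y) = quot_pi x + quot_pi y.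
Proof. exact: (Quotient.pi_add submod_pred x y). Qed.

Definition quot_scale a (u : quot_mod) : quot_mod := quot_pi (a *: repr u).

Lemma quot_piZ_subproof a x : quot_pi (a *: x) = quot_scale a (quot_pi x).
Proof.
apply/quot_pi_eq; rewrite -scalerBr; apply: rpredZ.
by apply/quot_pi_eq; rewrite /quot_pi reprK.
Qed.

Fact quot_scaleA a b u : quot_scale a (quot_scale b u) = quot_scale (a * b) u.
Proof.
have [x <-] := quot_pi_surj u.
by rewrite -!quot_piZ_subproof scalerA.
Qed.
Fact quot_scale1 : left_id 1 quot_scale.
Proof.
by move=> u; have [x <-] := quot_pi_surj u; rewrite -quot_piZ_subproof scale1r.
Qed.
Fact quot_scaleDr : right_distributive quot_scale +%R.
Proof.
move=> a u v; have [x <-] := quot_pi_surj u; have [y <-] := quot_pi_surj v.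
by rewrite -quot_piD -!quot_piZ_subproof -quot_piD scalerDr.
Qed.
Fact quot_scaleDl u : {morph quot_scale^~ u : a b / a + b}.
Proof.
move=> a b; have [x <-] := quot_pi_surj u.
by rewrite -!quot_piZ_subproof -quot_piD scalerDl.
Qed.
HB.instance Definition _ := GRing.Zmodule_isLmodule.Build R quot_mod
  quot_scaleA quot_scale1 quot_scaleDr quot_scaleDl.

Fact quot_pi_linear : linear quot_pi.
Proof. by move=> a x y; rewrite quot_piD quot_piZ_subproof. Qed.
HB.instance Definition _ :=
  GRing.isLinear.Build R M quot_mod *:%R quot_pi quot_pi_linear.

End QuotientModule.

(* Morphism modules are lmodTypes, and Ext below makes the objects live in the
   same universe as the carriers of modules: this smallness subsumes skeletal
   smallness. *)
Record lincat (k : comPzRingType) := LinCat {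
  obj :> Type;
  mor : obj -> obj -> lmodType k;
  idmor : forall X, mor X X;
  compose : forall X Y Z, mor Y Z -> mor X Y -> mor X Z;
  compA_axiom : forall X Y Z W (h : mor Z W) (g : mor Y Z) (f : mor X Y),
    compose h (compose g f) = compose (compose h g) f;
  comp1m_axiom : forall X Y (f : mor X Y), compose (idmor Y) f = f;
  compm1_axiom : forall X Y (f : mor X Y), compose f (idmor X) = f;
  comp_linear_l_axiom : forall X Y Z (f : mor X Y),
    linear (fun g : mor Y Z => compose g f);
  comp_linear_r_axiom : forall X Y Z (g : mor Y Z),
    linear (fun f : mor X Y => compose g f);
}.

Arguments mor {k C} X Y : rename.
Arguments idmor {k C} X : rename.
Arguments compose {k C X Y Z} g f : rename.

Notation "g \oc f" := (compose g f)
  (at level 40, left associativity) : cat_scope.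

Section LinCatTheory.
Context (k : comPzRingType) (C : lincat k).
Implicit Types A B D S X Y Z W : C.

Lemma composeA X Y Z W (h : mor Z W) (g : mor Y Z) (f : mor X Y) :
  h \oc (g \oc f) = h \oc g \oc f.
Proof. exact: compA_axiom. Qed.
Lemma comp1m X Y (f : mor X Y) : idmor Y \oc f = f.
Proof. exact: comp1m_axiom. Qed.
Lemma compm1 X Y (f : mor X Y) : f \oc idmor X = f.
Proof. exact: compm1_axiom. Qed.
Lemma compDl X Y Z (g g' : mor Y Z) (f : mor X Y) :
  (g + g') \oc f = g \oc f + g' \oc f.
Proof. by have := comp_linear_l_axiom f 1 g g'; rewrite !scale1r. Qed.
Lemma compDr X Y Z (g : mor Y Z) (f f' : mor X Y) :
  g \oc (f + f') = g \oc f + g \oc f'.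
Proof. by have := comp_linear_r_axiom g 1 f f'; rewrite !scale1r. Qed.
Lemma comp0m X Y Z (f : mor X Y) : (0 : mor Y Z) \oc f = 0.
Proof. by apply: (addIr (0 \oc f)); rewrite -compDl !add0r. Qed.
Lemma compm0 X Y Z (g : mor Y Z) : g \oc (0 : mor X Y) = 0.
Proof. by apply: (addIr (g \oc 0)); rewrite -compDr !add0r. Qed.
Lemma compZl X Y Z a (g : mor Y Z) (f : mor X Y) :
  (a *: g) \oc f = a *: (g \oc f).
Proof. by have := comp_linear_l_axiom f a g 0; rewrite comp0m !addr0. Qed.
Lemma compZr X Y Z a (g : mor Y Z) (f : mor X Y) :
  g \oc (a *: f) = a *: (g \oc f).
Proof. by have := comp_linear_r_axiom g a f 0; rewrite compm0 !addr0. Qed.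
Lemma compNl X Y Z (g : mor Y Z) (f : mor X Y) : (- g) \oc f = - (g \oc f).
Proof. by rewrite -scaleN1r compZl scaleN1r. Qed.
Lemma compNr X Y Z (g : mor Y Z) (f : mor X Y) : g \oc (- f) = - (g \oc f).
Proof. by rewrite -scaleN1r compZr scaleN1r. Qed.

Definition is_isom X Y (f : mor X Y) : Prop :=
  exists g : mor Y X, g \oc f = idmor X /\ f \oc g = idmor Y.

Definition is_zero_obj Z : Prop :=
  (forall X (f : mor X Z), f = 0) /\ (forall X (f : mor Z X), f = 0).

Definition is_biproduct A B S (i1 : mor A S) (i2 : mor B S)
    (p1 : mor S A) (p2 : mor S B) : Prop :=
  [/\ p1 \oc i1 = idmor A, p2 \oc i2 = idmor B, p1 \oc i2 = 0, p2 \oc i1 = 0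
    & i1 \oc p1 + i2 \oc p2 = idmor S].

Definition is_direct_sum n (A : 'I_n -> C) S : Prop :=
  exists (i : forall j, mor (A j) S) (p : forall j, mor S (A j)),
    [/\ forall j, p j \oc i j = idmor (A j),
        forall j l, j != l -> p l \oc i j = 0
      & \sum_j (i j \oc p j) = idmor S].

Definition is_summand A S : Prop :=
  exists B (i1 : mor A S) (i2 : mor B S) p1 p2, is_biproduct i1 i2 p1 p2.

(* X is a direct summand of a finite direct sum of copies of M. *)
Definition in_add (M X : C) : Prop :=
  exists n S, is_direct_sum (fun _ : 'I_n => M) S /\ is_summand X S.

Definition is_kernel X Y Z (i : mor X Y) (d : mor Y Z) : Prop :=
  d \oc i = 0 /\
  forall T (t : mor T Y), d \oc t = 0 -> exists! s : mor T X, i \oc s = t.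

Definition is_cokernel X Y Z (d : mor Y Z) (i : mor X Y) : Prop :=
  d \oc i = 0 /\
  forall T (t : mor Y T), t \oc i = 0 -> exists! s : mor Z T, s \oc d = t.

(*  X --i--> Y
    |f       |f'
    V        V
    X' -i'-> Y'  *)
Definition is_pushout X Y X' Y' (i : mor X Y) (f : mor X X')
    (i' : mor X' Y') (f' : mor Y Y') : Prop :=
  f' \oc i = i' \oc f /\
  forall T (u : mor Y T) (v : mor X' T), u \oc i = v \oc f ->
    exists! w : mor Y' T, w \oc f' = u /\ w \oc i' = v.

(*  Y' --d'--> Z'
    |f'        |f
    V          V
    Y  --d-->  Z  *)
Definition is_pullback Y Z Y' Z' (d : mor Y Z) (f : mor Z' Z)
    (d' : mor Y' Z') (f' : mor Y' Y) : Prop :=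
  d \oc f' = f \oc d' /\
  forall T (u : mor T Y) (v : mor T Z'), d \oc u = f \oc v ->
    exists! w : mor T Y', f' \oc w = u /\ d' \oc w = v.

Definition endo X : Type := mor X X.
HB.instance Definition _ X := GRing.Zmodule.on (endo X).
HB.instance Definition _ X := GRing.Zmodule_isPzRing.Build (endo X)
  (@composeA X X X X) (@comp1m X X) (@compm1 X X)
  (fun f g h => @compDl X X X f g h) (@compDr X X X).

Definition Gamma X : pzRingType := (endo X)^c.

Definition hom_from X Y : Type := mor X Y.
HB.instance Definition _ X Y := GRing.Zmodule.on (hom_from X Y).
Definition gamma_scale X Y (a : Gamma X) (f : hom_from X Y) : hom_from X Y :=
  (f : mor X Y) \oc (a : mor X X).
Fact gamma_scaleA X Y a b (f : hom_from X Y) :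
  gamma_scale a (gamma_scale b f) = gamma_scale (a * b) f.
Proof. by rewrite /gamma_scale -composeA. Qed.
Fact gamma_scale1 X Y : left_id 1 (@gamma_scale X Y).
Proof. by move=> f; apply: compm1. Qed.
Fact gamma_scaleDr X Y : right_distributive (@gamma_scale X Y) +%R.
Proof. by move=> a f g; apply: compDl. Qed.
Fact gamma_scaleDl X Y f : {morph (@gamma_scale X Y)^~ f : a b / a + b}.
Proof. by move=> a b; apply: compDr. Qed.
HB.instance Definition _ X Y :=
  GRing.Zmodule_isLmodule.Build (Gamma X) (hom_from X Y)
    (@gamma_scaleA X Y) (@gamma_scale1 X Y) (@gamma_scaleDr X Y)
    (@gamma_scaleDl X Y).

Definition hom_finite : Prop := forall X Y, finitely_generated (mor X Y).

Definition krull_schmidt : Prop := forall X, exists n (A : 'I_n -> C),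
  is_direct_sum A X /\ forall j, local_ring (endo (A j)).

Definition right_determined D X Y (f : mor X Y) : Prop :=
  forall T (g : mor T Y),
    (forall h : mor D T, exists s : mor D X, g \oc h = f \oc s) ->
    exists t : mor T X, g = f \oc t.

End LinCatTheory.

Section QuotientCategory.
Context (k : comPzRingType) (C : lincat k).

Record ideal := Ideal {
  ideal_mod : forall X Y : C, submodClosed (mor X Y);
  ideal_compl : forall X Y Z (g : mor Y Z) (f : mor X Y),
    f \in ideal_mod X Y -> g \oc f \in ideal_mod X Z;
  ideal_compr : forall X Y Z (g : mor Y Z) (f : mor X Y),
    g \in ideal_mod Y Z -> g \oc f \in ideal_mod X Z;
}.

Context (J : ideal).

Definition quot_hom (X Y : C) : lmodType k := quot_mod (ideal_mod J X Y).

Definition quot_comp X Y Z (u : quot_hom Y Z) (v : quot_hom X Y) :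
  quot_hom X Z := quot_pi _ ((repr u : mor Y Z) \oc (repr v : mor X Y)).

Lemma quot_compE X Y Z (g : mor Y Z) (f : mor X Y) :
  quot_comp (quot_pi _ g) (quot_pi _ f) = quot_pi _ (g \oc f).
Proof.
have reprP (A B : C) (h : mor A B) :
  exists2 r, r \in ideal_mod J A B
    & (repr (quot_pi (ideal_mod J A B) h) : mor A B) = h + r.
  exists ((repr (quot_pi (ideal_mod J A B) h) : mor A B) - h).
    by apply/quot_pi_eq; rewrite {1}/quot_pi reprK.
  by rewrite addrC subrK.
rewrite /quot_comp; have [r Jr ->] := reprP _ _ g.
have [s Js ->] := reprP _ _ f.
apply/quot_pi_eq; rewrite compDl !compDr -[X in X - _]addrA addrAC subrr add0r.
apply: rpredD; first exact: ideal_compl.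
by apply: rpredD; apply: ideal_compr.
Qed.

Fact quot_compA X Y Z W (h : quot_hom Z W) (g : quot_hom Y Z)
  (f : quot_hom X Y) :
  quot_comp h (quot_comp g f) = quot_comp (quot_comp h g) f.
Proof.
have [h' <-] := quot_pi_surj h; have [g' <-] := quot_pi_surj g.
by have [f' <-] := quot_pi_surj f; rewrite !quot_compE composeA.
Qed.
Fact quot_comp1m X Y (f : quot_hom X Y) : quot_comp (quot_pi _ (idmor Y)) f = f.
Proof. by have [f' <-] := quot_pi_surj f; rewrite quot_compE comp1m. Qed.
Fact quot_compm1 X Y (f : quot_hom X Y) : quot_comp f (quot_pi _ (idmor X)) = f.
Proof. by have [f' <-] := quot_pi_surj f; rewrite quot_compE compm1. Qed.
Fact quot_comp_linear_l X Y Z (f : quot_hom X Y) :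
  linear (fun g : quot_hom Y Z => quot_comp g f).
Proof.
move=> a g h; have [f' <-] := quot_pi_surj f; have [g' <-] := quot_pi_surj g.
have [h' <-] := quot_pi_surj h.
by rewrite -linearP !quot_compE compDl compZl linearP.
Qed.
Fact quot_comp_linear_r X Y Z (g : quot_hom Y Z) :
  linear (fun f : quot_hom X Y => quot_comp g f).
Proof.
move=> a f h; have [f' <-] := quot_pi_surj f; have [g' <-] := quot_pi_surj g.
have [h' <-] := quot_pi_surj h.
by rewrite -linearP !quot_compE compDr compZr linearP.
Qed.

Definition quot_cat : lincat k :=
  LinCat quot_compA quot_comp1m quot_compm1 quot_comp_linear_l
    quot_comp_linear_r.

Definition to_quot (X Y : C) (f : mor X Y) : @mor k quot_cat X Y :=
  quot_pi (ideal_mod J X Y) f.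

End QuotientCategory.

Section Functors.
Context (k : comPzRingType) (C : lincat k).

Record cofunctor := Cofunctor {
  fobj :> C -> lmodType k;
  fmap : forall X Y : C, mor X Y -> {linear fobj Y -> fobj X};
  fmap1 : forall X (x : fobj X), fmap (idmor X) x = x;
  fmapM : forall X Y Z (g : mor Y Z) (f : mor X Y) (x : fobj Z),
    fmap (g \oc f) x = fmap f (fmap g x);
  fmapP : forall X Y a (f g : mor X Y) (x : fobj Y),
    fmap (a *: f + g) x = a *: fmap f x + fmap g x;
}.

Definition represents (F : cofunctor) (T : C) : Prop :=
  exists phi : forall Z : C, {linear mor Z T -> F Z},
    (forall Z, bijective (phi Z)) /\
    (forall Z Z' (f : mor Z Z') (u : mor Z' T),
       phi Z (u \oc f) = fmap F f (phi Z' u)).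

Definition representable (F : cofunctor) : Prop := exists T, represents F T.

End Functors.

(* Quillen's axioms in the self-dual form of Buehler's survey. The existential
   premises and conclusions say that a morphism is an inflation or a
   deflation. *)
Record exact_cat (k : comPzRingType) := ExactCat {
  ecat :> lincat k;
  conf : forall X E Y : ecat, mor X E -> mor E Y -> Prop;
  ex_zero : exists Z : ecat, is_zero_obj Z;
  ex_biproduct : forall A B : ecat, exists S (i1 : mor A S) (i2 : mor B S)
    (p1 : mor S A) (p2 : mor S B), is_biproduct i1 i2 p1 p2;
  conf_ker : forall (X E Y : ecat) (i : mor X E) (d : mor E Y),
    conf i d -> is_kernel i d;
  conf_coker : forall (X E Y : ecat) (i : mor X E) (d : mor E Y),
    conf i d -> is_cokernel d i;
  conf_iso : forall (X E Y X' E' Y' : ecat) (i : mor X E) (d : mor E Y)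
    (i' : mor X' E') (d' : mor E' Y') (a : mor X X') (e : mor E E')
    (b : mor Y Y'),
    is_isom a -> is_isom e -> is_isom b -> e \oc i = i' \oc a ->
    b \oc d = d' \oc e -> conf i d -> conf i' d';
  ex_id_infl : forall X : ecat, exists Y (d : mor X Y), conf (idmor X) d;
  ex_id_defl : forall Y : ecat, exists X (i : mor X Y), conf i (idmor Y);
  ex_comp_infl : forall (X Y Z : ecat) (i : mor X Y) (j : mor Y Z),
    (exists A (d : mor Y A), conf i d) -> (exists A (d : mor Z A), conf j d) ->
    exists A (d : mor Z A), conf (j \oc i) d;
  ex_comp_defl : forall (X Y Z : ecat) (d : mor X Y) (e : mor Y Z),
    (exists A (i : mor A X), conf i d) -> (exists A (i : mor A Y), conf i e) ->
    exists A (i : mor A X), conf i (e \oc d);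
  ex_pushout : forall (X Y X' : ecat) (i : mor X Y) (f : mor X X'),
    (exists A (d : mor Y A), conf i d) ->
    exists Y' (i' : mor X' Y') (f' : mor Y Y'),
      is_pushout i f i' f' /\ (exists A (d : mor Y' A), conf i' d);
  ex_pullback : forall (Y Z Z' : ecat) (d : mor Y Z) (f : mor Z' Z),
    (exists A (i : mor A Y), conf i d) ->
    exists Y' (d' : mor Y' Z') (f' : mor Y' Y),
      is_pullback d f d' f' /\ (exists A (i : mor A Y'), conf i d');
}.

Definition inflation (k : comPzRingType) (C : exact_cat k) (X Y : C)
  (i : mor X Y) : Prop := exists A (d : mor Y A), conf i d.

Definition deflation (k : comPzRingType) (C : exact_cat k) (X Y : C)
  (d : mor X Y) : Prop := exists A (i : mor A X), conf i d.

Section ExactTheory.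
Context (k : comPzRingType) (C : exact_cat k).
Implicit Types A B S T X Y Z E : C.

Lemma kernel_monic X Y Z (i : mor X Y) (d : mor Y Z) T (s t : mor T X) :
  is_kernel i d -> i \oc s = i \oc t -> s = t.
Proof.
case=> di0 univ e; have [|r [_ u]] := univ T (i \oc t).
  by rewrite composeA di0 comp0m.
by rewrite -(u s e) -(u t).
Qed.

Lemma cokernel_epic X Y Z (i : mor X Y) (d : mor Y Z) T (s t : mor Z T) :
  is_cokernel d i -> s \oc d = t \oc d -> s = t.
Proof.
case=> di0 univ e; have [|r [_ u]] := univ T (t \oc d).
  by rewrite -composeA di0 compm0.
by rewrite -(u s e) -(u t).
Qed.

Lemma cokernel_unique X Y Z Z' (i : mor X Y) (d : mor Y Z) (d' : mor Y Z') :
  is_cokernel d i -> is_cokernel d' i ->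
  exists2 b : mor Z Z', is_isom b & b \oc d = d'.
Proof.
move=> cd cd'; have [b [eb _]] := cd.2 _ d' cd'.1.
have [c [ec _]] := cd'.2 _ d cd.1.
exists b => //; exists c; split.
  by apply: (cokernel_epic cd); rewrite -composeA eb ec comp1m.
by apply: (cokernel_epic cd'); rewrite -composeA ec eb comp1m.
Qed.

Lemma kernel_unique X X' Y Z (i : mor X Y) (i' : mor X' Y) (d : mor Y Z) :
  is_kernel i d -> is_kernel i' d ->
  exists2 a : mor X X', is_isom a & i' \oc a = i.
Proof.
move=> ki ki'; have [b [eb _]] := ki.2 _ i' ki'.1.
have [c [ec _]] := ki'.2 _ i ki.1.
exists c => //; exists b; split.
  by apply: (kernel_monic ki); rewrite composeA eb ec compm1.
by apply: (kernel_monic ki'); rewrite composeA ec eb compm1.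
Qed.

Lemma is_iso_id X : is_isom (idmor X).
Proof. by exists (idmor X); rewrite comp1m. Qed.

Lemma inflation_conf X Y Z (i : mor X Y) (d : mor Y Z) :
  inflation i -> is_cokernel d i -> conf i d.
Proof.
move=> [A [d' cd']] cd.
have [b ib eb] := cokernel_unique (conf_coker cd') cd.
apply: (conf_iso (@is_iso_id _) (@is_iso_id _) ib _ _ cd').
  by rewrite comp1m compm1.
by rewrite compm1.
Qed.

Lemma deflation_conf X Y Z (i : mor X Y) (d : mor Y Z) :
  deflation d -> is_kernel i d -> conf i d.
Proof.
move=> [A [i' ci']] ki.
have [a ia ea] := kernel_unique (conf_ker ci') ki.
apply: (conf_iso ia (@is_iso_id _) (@is_iso_id _) _ _ ci').
  by rewrite comp1m ea.
by rewrite comp1m compm1.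
Qed.

Lemma pushout_ext X Y X' Y' (i : mor X Y) (f : mor X X') (i' : mor X' Y')
    (f' : mor Y Y') T (s t : mor Y' T) :
  is_pushout i f i' f' -> s \oc f' = t \oc f' -> s \oc i' = t \oc i' -> s = t.
Proof.
case=> e univ e1 e2; have [|r [_ u]] := univ T (t \oc f') (t \oc i').
  by rewrite -!composeA e.
by rewrite -(u s) // -(u t).
Qed.

Lemma pullback_ext Y Z Y' Z' (d : mor Y Z) (f : mor Z' Z) (d' : mor Y' Z')
    (f' : mor Y' Y) T (s t : mor T Y') :
  is_pullback d f d' f' -> f' \oc s = f' \oc t -> d' \oc s = d' \oc t -> s = t.
Proof.
case=> e univ e1 e2; have [|r [_ u]] := univ T (f' \oc t) (d' \oc t).
  by rewrite !composeA e.
by rewrite -(u s) // -(u t).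
Qed.

Lemma pushout_inflation X Y X' Y' (i : mor X Y) (f : mor X X')
    (i' : mor X' Y') (f' : mor Y Y') :
  is_pushout i f i' f' -> inflation i -> inflation i'.
Proof.
move=> po infi; have [P [j [g [poP [A [d cd]]]]]] := ex_pushout f infi.
have [w [[w1 w2] _]] := poP.2 _ f' i' po.1.
have [v [[v1 v2] _]] := po.2 _ g j poP.1.
have vw : v \oc w = idmor P.
  by apply: (pushout_ext poP); rewrite -composeA ?w1 ?w2 ?v1 ?v2 comp1m.
have wv : w \oc v = idmor Y'.
  by apply: (pushout_ext po); rewrite -composeA ?v1 ?v2 ?w1 ?w2 comp1m.
have iw : is_isom w by exists v.
exists A, (d \oc v).
apply: (conf_iso (@is_iso_id _) iw (@is_iso_id _) _ _ cd).
  by rewrite compm1.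
by rewrite comp1m -composeA vw compm1.
Qed.

Lemma bip_ex A B : exists b : { S : C & (mor A S * mor B S *
   mor S A * mor S B)%type },
   is_biproduct (projT2 b).1.1.1 (projT2 b).1.1.2 (projT2 b).1.2 (projT2 b).2.
Proof.
have [S [i1 [i2 [p1 [p2 b]]]]] := ex_biproduct A B.
by exists (existT _ S (i1, i2, p1, p2)).
Qed.

Definition bip A B : C := projT1 (projT1 (cid (bip_ex A B))).
Definition in1 A B : mor A (bip A B) :=
  (projT2 (projT1 (cid (bip_ex A B)))).1.1.1.
Definition in2 A B : mor B (bip A B) :=
  (projT2 (projT1 (cid (bip_ex A B)))).1.1.2.
Definition pr1 A B : mor (bip A B) A :=
  (projT2 (projT1 (cid (bip_ex A B)))).1.2.
Definition pr2 A B : mor (bip A B) B :=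
  (projT2 (projT1 (cid (bip_ex A B)))).2.
Arguments in1 {A B}.
Arguments in2 {A B}.
Arguments pr1 {A B}.
Arguments pr2 {A B}.

Lemma bipP A B : is_biproduct (@in1 A B) in2 pr1 pr2.
Proof. exact: (projT2 (cid (bip_ex A B))). Qed.

Lemma pr1in1 A B : (@pr1 A B) \oc in1 = idmor A.
Proof. by case: (bipP A B). Qed.
Lemma pr2in2 A B : (@pr2 A B) \oc in2 = idmor B.
Proof. by case: (bipP A B). Qed.
Lemma pr1in2 A B : (@pr1 A B) \oc in2 = 0.
Proof. by case: (bipP A B). Qed.
Lemma pr2in1 A B : (@pr2 A B) \oc in1 = 0.
Proof. by case: (bipP A B). Qed.
Lemma bip_id A B : in1 \oc pr1 + in2 \oc pr2 = idmor (bip A B).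
Proof. by case: (bipP A B). Qed.

Lemma pr1in1A A B X (f : mor X A) : (pr1 : mor (bip A B) A) \oc (in1 \oc f) = f.
Proof. by rewrite composeA pr1in1 comp1m. Qed.
Lemma pr2in2A A B X (f : mor X B) : (pr2 : mor (bip A B) B) \oc (in2 \oc f) = f.
Proof. by rewrite composeA pr2in2 comp1m. Qed.
Lemma pr1in2A A B X (f : mor X B) : (pr1 : mor (bip A B) A) \oc (in2 \oc f) = 0.
Proof. by rewrite composeA pr1in2 comp0m. Qed.
Lemma pr2in1A A B X (f : mor X A) : (pr2 : mor (bip A B) B) \oc (in1 \oc f) = 0.
Proof. by rewrite composeA pr2in1 comp0m. Qed.

Definition bipE := (compDl, compDr, =^~ composeA, pr1in1A, pr2in2A, pr1in2A,
  pr2in1A, pr1in1, pr2in2, pr1in2, pr2in1, comp0m, compm0, comp1m, compm1,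
  addr0, add0r).

Lemma bip_ext_to A B X (f g : mor X (bip A B)) :
  pr1 \oc f = pr1 \oc g -> pr2 \oc f = pr2 \oc g -> f = g.
Proof.
by move=> e1 e2; rewrite -[f]comp1m -[g]comp1m -bip_id !compDl -!composeA e1 e2.
Qed.
Lemma bip_ext_from A B X (f g : mor (bip A B) X) :
  f \oc in1 = g \oc in1 -> f \oc in2 = g \oc in2 -> f = g.
Proof.
by move=> e1 e2; rewrite -[f]compm1 -[g]compm1 -bip_id !compDr !composeA e1 e2.
Qed.

Definition bip_map A B A' B' (f : mor A A') (g : mor B B') :
  mor (bip A B) (bip A' B') := in1 \oc f \oc pr1 + in2 \oc g \oc pr2.
Definition diag X : mor X (bip X X) := in1 + in2.
Definition codiag X : mor (bip X X) X := pr1 + pr2.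

Lemma bip_mapM A B A' B' A'' B'' (f : mor A A') (g : mor B B')
    (f' : mor A' A'') (g' : mor B' B'') :
  bip_map f' g' \oc bip_map f g = bip_map (f' \oc f) (g' \oc g).
Proof. by rewrite /bip_map !bipE. Qed.

Lemma bip_map_coker X E Y X' E' Y' (i : mor X E) (d : mor E Y)
    (i' : mor X' E') (d' : mor E' Y') :
  is_cokernel d i -> is_cokernel d' i' ->
  is_cokernel (bip_map d d') (bip_map i i').
Proof.
move=> c c'; split; first by rewrite bip_mapM c.1 c'.1 /bip_map !bipE.
move=> T t e.
have [|s1 [e1 _]] := c.2 _ (t \oc in1).
  have := congr1 (fun z => z \oc in1) e.
  by rewrite /bip_map !bipE.
have [|s2 [e2 _]] := c'.2 _ (t \oc in2).
  have := congr1 (fun z => z \oc in2) e.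
  by rewrite /bip_map !bipE.
exists (s1 \oc pr1 + s2 \oc pr2); split.
  by apply: bip_ext_from; rewrite /bip_map !bipE ?e1 ?e2.
move=> s es; apply: bip_ext_from; rewrite !bipE.
  apply: (cokernel_epic c); rewrite e1 -es /bip_map !bipE //.
by apply: (cokernel_epic c'); rewrite e2 -es /bip_map !bipE.
Qed.

Lemma bip_map_infl1 X E B (i : mor X E) :
  inflation i -> inflation (bip_map i (idmor B)).
Proof.
move=> infi; apply: (@pushout_inflation _ _ _ _ i in1 _ in1) => //.
split; first by rewrite /bip_map !bipE.
move=> T u v e; exists (u \oc pr1 + v \oc in2 \oc pr2); split.
  split; first by rewrite !bipE.
  by apply: bip_ext_from; rewrite /bip_map !bipE.
move=> w [e1 e2]; apply: bip_ext_from; rewrite !bipE -?e1 // -e2.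
by rewrite /bip_map !bipE.
Qed.

Lemma bip_map_infl2 X E B (i : mor X E) :
  inflation i -> inflation (bip_map (idmor B) i).
Proof.
move=> infi; apply: (@pushout_inflation _ _ _ _ i in2 _ in2) => //.
split; first by rewrite /bip_map !bipE.
move=> T u v e; exists (u \oc pr2 + v \oc in1 \oc pr1); split.
  split; first by rewrite !bipE.
  by apply: bip_ext_from; rewrite /bip_map !bipE.
move=> w [e1 e2]; apply: bip_ext_from; rewrite !bipE -?e1 // -e2.
by rewrite /bip_map !bipE.
Qed.

Lemma conf_bip X E Y X' E' Y' (i : mor X E) (d : mor E Y)
    (i' : mor X' E') (d' : mor E' Y') :
  conf i d -> conf i' d' -> conf (bip_map i i') (bip_map d d').
Proof.
move=> c c'; apply: inflation_conf; last first.
  by apply: bip_map_coker; apply: conf_coker.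
have -> : bip_map i i' = bip_map (idmor E) i' \oc bip_map i (idmor X').
  by rewrite bip_mapM comp1m compm1.
apply: ex_comp_infl; first by apply: bip_map_infl1; exists Y, d.
by apply: bip_map_infl2; exists Y', d'.
Qed.

(* A conflation X -> E -> Y represents an element of Ext^1(Y, X): the quotient
   object comes first. *)
Record conflation (Y X : C) := Conflation {
  mid : C;
  infl : mor X mid;
  defl : mor mid Y;
  conflationP : conf infl defl
}.
Arguments Conflation {Y X mid infl defl}.

HB.instance Definition _ Y X := gen_eqMixin (conflation Y X).
HB.instance Definition _ Y X := gen_choiceMixin (conflation Y X).

Definition conf_mor Y X Y' X' (c : conflation Y X) (c' : conflation Y' X')
    (a : mor X X') (b : mor Y Y') : Prop :=
  exists e : mor (mid c) (mid c'),
    e \oc infl c = infl c' \oc a /\ defl c' \oc e = b \oc defl c.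

(* By the short five lemma u is automatically invertible; see conf_equiv_sym. *)
Definition conf_equiv Y X (c c' : conflation Y X) : Prop :=
  exists u : mor (mid c) (mid c'),
    u \oc infl c = infl c' /\ defl c' \oc u = defl c.

Lemma conf_equivE Y X (c c' : conflation Y X) :
  conf_equiv c c' <-> conf_mor c c' (idmor X) (idmor Y).
Proof.
by split=> -[u [e1 e2]]; exists u; rewrite ?compm1 ?comp1m in e1 e2 *.
Qed.

Lemma conf_mor_comp Y X Y' X' Y'' X'' (c : conflation Y X)
    (c' : conflation Y' X') (c'' : conflation Y'' X'') (a : mor X X')
    (b : mor Y Y') (a' : mor X' X'') (b' : mor Y' Y'') :
  conf_mor c c' a b -> conf_mor c' c'' a' b' ->
  conf_mor c c'' (a' \oc a) (b' \oc b).
Proof.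
move=> [e [e1 e2]] [f [f1 f2]]; exists (f \oc e).
split; first by rewrite -composeA e1 composeA f1 composeA.
by rewrite composeA f2 -!composeA e2.
Qed.

Lemma conf_equiv_refl Y X (c : conflation Y X) : conf_equiv c c.
Proof. by exists (idmor _); rewrite comp1m compm1. Qed.

Lemma conf_equiv_trans Y X (c c' c'' : conflation Y X) :
  conf_equiv c c' -> conf_equiv c' c'' -> conf_equiv c c''.
Proof.
move=> /conf_equivE m /conf_equivE m'; apply/conf_equivE.
by have := conf_mor_comp m m'; rewrite !comp1m.
Qed.

(* the inverse is induced by p + i r on the pullback P of the deflations *)
Lemma conf_equiv_sym Y X (c c' : conflation Y X) :
  conf_equiv c c' -> conf_equiv c' c.
Proof.
case: c c' => [E i d cid] [E' i' d' cid'] [/= u [ui du]].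
have [d0 univd] := conf_coker cid.
have [k0 univk] := conf_ker cid'.
have defld : deflation d by exists X, i.
have [P [q [p [pb [A [j cj]]]]]] := ex_pullback d' defld.
have [t [[pt qt] _]] : exists! w, p \oc w = 0 /\ q \oc w = i'.
  by apply: pb.2; rewrite compm0 k0.
have [r [tr _]] : exists! r, i' \oc r = q - u \oc p.
  by apply: univk; rewrite compDr compNr -pb.1 composeA du subrr.
have rt : r \oc t = idmor X.
  apply: (kernel_monic (conf_ker cid')).
  by rewrite composeA tr compDl qt compNl -composeA pt compm0 subr0 compm1.
have cq : is_cokernel q j by apply: conf_coker.
have qj : q \oc j = 0 := cq.1.
have ej : (p + i \oc r) \oc j = 0.
  have ur : i' \oc (r \oc j) = - (u \oc p \oc j).
    by rewrite composeA tr compDl qj add0r compNl.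
  have [z [iz _]] : exists! z, i \oc z = p \oc j.
    apply: (conf_ker cid).2.
    by rewrite composeA pb.1 -composeA qj compm0.
  rewrite compDl -composeA.
  have -> : r \oc j = - z.
    apply: (kernel_monic (conf_ker cid')); rewrite ur compNr -ui -!composeA.
    by rewrite iz.
  by rewrite compNr iz subrr.
have [v [vq _]] := cq.2 _ _ ej.
exists v; split => /=.
  by rewrite -qt composeA vq compDl pt add0r -composeA rt compm1.
apply: (cokernel_epic cq); rewrite -composeA vq compDr composeA d0 comp0m.
by rewrite addr0 pb.1.
Qed.

Lemma push_ex Y X X' (c : conflation Y X) (f : mor X X') :
  exists c' : conflation Y X', exists h : mor (mid c) (mid c'),
    is_pushout (infl c) f (infl c') h /\ defl c' \oc h = defl c.
Proof.
case: c => [E i d cid] /=; have cd := conf_coker cid.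
have infi : inflation i by exists Y, d.
have [P [i' [h [po infi']]]] := ex_pushout f infi.
have [d' [[d'h d'i] _]] : exists! w, w \oc h = d /\ w \oc i' = 0.
  by apply: po.2; rewrite comp0m cd.1.
suff cd' : is_cokernel d' i'.
  by exists (Conflation (inflation_conf infi' cd')), h.
split=> // T t ti; have [|s [sd _]] := cd.2 _ (t \oc h).
  by rewrite -composeA po.1 composeA ti comp0m.
exists s; split.
  by apply: (pushout_ext po); rewrite -composeA ?d'h ?d'i ?sd ?ti ?compm0.
by move=> s' es; apply: (cokernel_epic cd); rewrite sd -es -composeA d'h.
Qed.

Lemma pull_ex Y Y' X (c : conflation Y X) (g : mor Y' Y) :
  exists c' : conflation Y' X, exists h : mor (mid c') (mid c),
    is_pullback (defl c) g (defl c') h /\ h \oc infl c' = infl c.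
Proof.
case: c => [E i d cid] /=; have kd := conf_ker cid.
have defd : deflation d by exists X, i.
have [P [d' [h [pb defd']]]] := ex_pullback g defd.
have [i' [[hi' d'i] _]] : exists! w, h \oc w = i /\ d' \oc w = 0.
  by apply: pb.2; rewrite compm0 kd.1.
suff kd' : is_kernel i' d'.
  by exists (Conflation (deflation_conf defd' kd')), h.
split=> // T t dt; have [|s [sd _]] := kd.2 _ (h \oc t).
  by rewrite composeA pb.1 -composeA dt compm0.
exists s; split.
  by apply: (pullback_ext pb); rewrite composeA ?hi' ?d'i ?sd ?dt ?comp0m.
by move=> s' es; apply: (kernel_monic kd); rewrite sd -es composeA hi'.
Qed.

Definition push Y X X' (f : mor X X') (c : conflation Y X) : conflation Y X' :=
  projT1 (cid (push_ex c f)).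
Definition pull Y Y' X (g : mor Y' Y) (c : conflation Y X) : conflation Y' X :=
  projT1 (cid (pull_ex c g)).

Lemma pushP Y X X' (f : mor X X') (c : conflation Y X) :
  exists h : mor (mid c) (mid (push f c)),
    is_pushout (infl c) f (infl (push f c)) h /\ defl (push f c) \oc h = defl c.
Proof. exact: (projT2 (cid (push_ex c f))). Qed.
Lemma pullP Y Y' X (g : mor Y' Y) (c : conflation Y X) :
  exists h : mor (mid (pull g c)) (mid c),
    is_pullback (defl c) g (defl (pull g c)) h /\
    h \oc infl (pull g c) = infl c.
Proof. exact: (projT2 (cid (pull_ex c g))). Qed.

Lemma push_mor Y X X' (f : mor X X') (c : conflation Y X) :
  conf_mor c (push f c) f (idmor Y).
Proof.
have [h [po e]] := pushP f c; exists h; split; first exact: po.1.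
by rewrite comp1m.
Qed.
Lemma pull_mor Y Y' X (g : mor Y' Y) (c : conflation Y X) :
  conf_mor (pull g c) c (idmor X) g.
Proof.
have [h [pb e]] := pullP g c; exists h; split; last exact: pb.1.
by rewrite compm1.
Qed.

Lemma conf_mor_push_pull Y X Y' X' (c : conflation Y X) (c' : conflation Y' X')
    (a : mor X X') (b : mor Y Y') :
  conf_mor c c' a b -> conf_equiv (push a c) (pull b c').
Proof.
move=> [e [ei de]]; have [h [po dh]] := pushP a c.
have [q [pb qi]] := pullP b c'.
have [w [[wh wi] _]] := po.2 _ e (infl c') ei.
have dw : defl c' \oc w = b \oc defl (push a c).
  apply: (pushout_ext po); rewrite -!composeA; first by rewrite wh dh de.
  rewrite wi (conf_ker (conflationP c')).1.
  by rewrite (conf_ker (conflationP (push a c))).1 compm0.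
have [v [[qv dv] _]] := pb.2 _ w (defl (push a c)) dw.
exists v; split=> //; apply: (pullback_ext pb); rewrite composeA.
  by rewrite qv wi qi.
rewrite dv (conf_ker (conflationP (push a c))).1.
by rewrite (conf_ker (conflationP (pull b c'))).1.
Qed.

Definition conf_equivb Y X : rel (conflation Y X) :=
  fun c c' => `[< conf_equiv c c' >].

Fact conf_equivb_refl Y X : reflexive (@conf_equivb Y X).
Proof. by move=> c; apply/asboolP/conf_equiv_refl. Qed.
Fact conf_equivb_sym Y X : symmetric (@conf_equivb Y X).
Proof.
by move=> c c'; apply/asboolP/asboolP; apply: conf_equiv_sym.
Qed.
Fact conf_equivb_trans Y X : transitive (@conf_equivb Y X).
Proof.
move=> c c' c'' /asboolP e /asboolP e'; apply/asboolP.
exact: conf_equiv_trans e e'.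
Qed.
Canonical conf_equiv_rel Y X := EquivRel (@conf_equivb Y X)
  (@conf_equivb_refl Y X) (@conf_equivb_sym Y X) (@conf_equivb_trans Y X).

Definition Ext Y X : Type := {eq_quot (@conf_equivb Y X)}%qT.
HB.instance Definition _ Y X := Choice.on (Ext Y X).

Definition cls Y X (c : conflation Y X) : Ext Y X :=
  \pi_({eq_quot (@conf_equivb Y X)})%qT c.

Lemma cls_eq Y X (c c' : conflation Y X) : cls c = cls c' <-> conf_equiv c c'.
Proof. by split=> [/eqmodP/asboolP|e] //; apply/eqmodP/asboolP. Qed.

Lemma cls_surj Y X (x : Ext Y X) : exists c, cls c = x.
Proof. by exists (repr x); apply: reprK. Qed.

Definition ext_push Y X X' (f : mor X X') (x : Ext Y X) : Ext Y X' :=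
  cls (push f (repr x)).
Definition ext_pull Y Y' X (g : mor Y' Y) (x : Ext Y X) : Ext Y' X :=
  cls (pull g (repr x)).

Lemma repr_equiv Y X (c : conflation Y X) : conf_equiv c (repr (cls c)).
Proof. by apply/cls_eq; rewrite /cls reprK. Qed.

Lemma mor_idr Y X Z (c : conflation Y X) (c' : conflation Y Z) (f : mor X Z) :
  conf_mor c c' f (idmor Y) -> conf_equiv (push f c) c'.
Proof.
move=> m; apply: conf_equiv_trans (conf_mor_push_pull m) _.
exact/conf_equivE/pull_mor.
Qed.
Lemma mor_idl Y Z X (c : conflation Y X) (c' : conflation Z X) (g : mor Y Z) :
  conf_mor c c' (idmor X) g -> conf_equiv c (pull g c').
Proof.
move=> m; apply: conf_equiv_trans _ (conf_mor_push_pull m).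
exact/conf_equivE/push_mor.
Qed.

Lemma ext_push_cls Y X X' (f : mor X X') (c : conflation Y X) :
  ext_push f (cls c) = cls (push f c).
Proof.
apply/esym/cls_eq; apply: mor_idr.
have /conf_equivE m := repr_equiv c.
by have := conf_mor_comp m (push_mor f _); rewrite compm1 comp1m.
Qed.
Lemma ext_pull_cls Y Y' X (g : mor Y' Y) (c : conflation Y X) :
  ext_pull g (cls c) = cls (pull g c).
Proof.
apply/cls_eq; apply: mor_idl.
have /conf_equivE m := conf_equiv_sym (repr_equiv c).
by have := conf_mor_comp (pull_mor g _) m; rewrite compm1 comp1m.
Qed.

Lemma ext_mor Y X Y' X' (c : conflation Y X) (c' : conflation Y' X')
    (a : mor X X') (b : mor Y Y') :
  conf_mor c c' a b -> ext_push a (cls c) = ext_pull b (cls c').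
Proof.
by move=> m; rewrite ext_push_cls ext_pull_cls; apply/cls_eq/conf_mor_push_pull.
Qed.

Lemma ext_push1 Y X (x : Ext Y X) : ext_push (idmor X) x = x.
Proof.
have [c <-] := cls_surj x; rewrite ext_push_cls; apply/cls_eq/mor_idr.
exact/conf_equivE/conf_equiv_refl.
Qed.
Lemma ext_pull1 Y X (x : Ext Y X) : ext_pull (idmor Y) x = x.
Proof.
have [c <-] := cls_surj x; rewrite ext_pull_cls; apply/esym/cls_eq/mor_idl.
exact/conf_equivE/conf_equiv_refl.
Qed.
Lemma ext_push_comp Y X X' X'' (g : mor X' X'') (f : mor X X') (x : Ext Y X) :
  ext_push (g \oc f) x = ext_push g (ext_push f x).
Proof.
have [c <-] := cls_surj x; rewrite !ext_push_cls; apply/cls_eq/mor_idr.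
by have := conf_mor_comp (push_mor f c) (push_mor g _); rewrite comp1m.
Qed.
Lemma ext_pull_comp Y Y' Y'' X (g : mor Y' Y) (f : mor Y'' Y') (x : Ext Y X) :
  ext_pull (g \oc f) x = ext_pull f (ext_pull g x).
Proof.
have [c <-] := cls_surj x; rewrite !ext_pull_cls; apply/esym/cls_eq/mor_idl.
by have := conf_mor_comp (pull_mor f _) (pull_mor g c); rewrite comp1m.
Qed.
Lemma ext_push_pull Y Y' X X' (g : mor Y' Y) (f : mor X X') (x : Ext Y X) :
  ext_push f (ext_pull g x) = ext_pull g (ext_push f x).
Proof.
have [c <-] := cls_surj x; rewrite ext_push_cls ext_pull_cls; apply: ext_mor.
by have := conf_mor_comp (pull_mor g c) (push_mor f c); rewrite comp1m compm1.
Qed.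

Definition conf_sum Y X Y' X' (c : conflation Y X) (c' : conflation Y' X') :
    conflation (bip Y Y') (bip X X') :=
  Conflation (conf_bip (conflationP c) (conflationP c')).

Lemma conf_sum_mor Y X Y' X' Y1 X1 Y1' X1' (c : conflation Y X)
    (c' : conflation Y' X') (c1 : conflation Y1 X1) (c1' : conflation Y1' X1')
    (a : mor X X1) (b : mor Y Y1) (a' : mor X' X1') (b' : mor Y' Y1') :
  conf_mor c c1 a b -> conf_mor c' c1' a' b' ->
  conf_mor (conf_sum c c') (conf_sum c1 c1') (bip_map a a') (bip_map b b').
Proof.
move=> [e [e1 e2]] [f [f1 f2]]; exists (bip_map e f) => /=.
by rewrite !bip_mapM e1 f1 e2 f2.
Qed.

Definition ext_sum Y X Y' X' (x : Ext Y X) (y : Ext Y' X') :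
    Ext (bip Y Y') (bip X X') := cls (conf_sum (repr x) (repr y)).

Lemma bip_map1 A B : bip_map (idmor A) (idmor B) = idmor (bip A B).
Proof. by rewrite /bip_map !compm1 bip_id. Qed.

Lemma ext_sum_cls Y X Y' X' (c : conflation Y X) (c' : conflation Y' X') :
  ext_sum (cls c) (cls c') = cls (conf_sum c c').
Proof.
apply/esym/cls_eq/conf_equivE; rewrite -!bip_map1.
by apply: conf_sum_mor; apply/conf_equivE/repr_equiv.
Qed.

Lemma ext_push_sum Y X X1 Y' X' X1' (a : mor X X1) (a' : mor X' X1')
    (x : Ext Y X) (y : Ext Y' X') :
  ext_push (bip_map a a') (ext_sum x y) =
  ext_sum (ext_push a x) (ext_push a' y).
Proof.
have [c <-] := cls_surj x; have [c' <-] := cls_surj y.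
rewrite !(ext_push_cls, ext_sum_cls); apply/cls_eq/mor_idr.
by rewrite -bip_map1; apply: conf_sum_mor; apply: push_mor.
Qed.
Lemma ext_pull_sum Y Y1 X Y' Y1' X' (b : mor Y1 Y) (b' : mor Y1' Y')
    (x : Ext Y X) (y : Ext Y' X') :
  ext_pull (bip_map b b') (ext_sum x y) =
  ext_sum (ext_pull b x) (ext_pull b' y).
Proof.
have [c <-] := cls_surj x; have [c' <-] := cls_surj y.
rewrite !(ext_pull_cls, ext_sum_cls); apply/esym/cls_eq/mor_idl.
by rewrite -bip_map1; apply: conf_sum_mor; apply: pull_mor.
Qed.
Lemma ext_diag Y X (x : Ext Y X) :
  ext_push (diag X) x = ext_pull (diag Y) (ext_sum x x).
Proof.
have [c <-] := cls_surj x; rewrite ext_sum_cls; apply: ext_mor.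
by exists (diag (mid c)); rewrite /= /diag /bip_map !bipE.
Qed.
Lemma ext_codiag Y X (x : Ext Y X) :
  ext_push (codiag X) (ext_sum x x) = ext_pull (codiag Y) x.
Proof.
have [c <-] := cls_surj x; rewrite ext_sum_cls; apply: ext_mor.
by exists (codiag (mid c)); rewrite /= /codiag /bip_map !bipE.
Qed.

(* The Baer sum: pull x (+) y back along the diagonal of Y and push it out along
   the codiagonal of X. *)
Definition ext_add Y X (x y : Ext Y X) : Ext Y X :=
  ext_push (codiag X) (ext_pull (diag Y) (ext_sum x y)).

Lemma codiag_map X X' (f : mor X X') :
  codiag X' \oc bip_map f f = f \oc codiag X.
Proof. by rewrite /codiag /bip_map !bipE. Qed.
Lemma diag_map X X' (f : mor X X') : bip_map f f \oc diag X = diag X' \oc f.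
Proof. by rewrite /diag /bip_map !bipE. Qed.

Lemma ext_pushD Y X X' (f : mor X X') (x y : Ext Y X) :
  ext_push f (ext_add x y) = ext_add (ext_push f x) (ext_push f y).
Proof.
by rewrite /ext_add -ext_push_comp -codiag_map ext_push_comp ext_push_pull
  ext_push_sum.
Qed.
Lemma ext_pullD Y Y' X (g : mor Y' Y) (x y : Ext Y X) :
  ext_pull g (ext_add x y) = ext_add (ext_pull g x) (ext_pull g y).
Proof.
by rewrite /ext_add -ext_push_pull -ext_pull_comp -diag_map ext_pull_comp
  ext_pull_sum.
Qed.
Lemma ext_push_add Y X X' (f g : mor X X') (x : Ext Y X) :
  ext_push (f + g) x = ext_add (ext_push f x) (ext_push g x).
Proof.
have -> : f + g = codiag X' \oc (bip_map f g \oc diag X).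
  by rewrite /codiag /bip_map /diag !bipE.
by rewrite !ext_push_comp ext_diag ext_push_pull ext_push_sum.
Qed.
Lemma ext_pull_add Y Y' X (f g : mor Y' Y) (x : Ext Y X) :
  ext_pull (f + g) x = ext_add (ext_pull f x) (ext_pull g x).
Proof.
have -> : f + g = codiag Y \oc (bip_map f g \oc diag Y').
  by rewrite /codiag /bip_map /diag !bipE.
by rewrite !ext_pull_comp -ext_codiag -!ext_push_pull ext_pull_sum.
Qed.

Definition bip_swap A B : mor (bip A B) (bip B A) := in1 \oc pr2 + in2 \oc pr1.
Definition bip_assoc A B D : mor (bip (bip A B) D) (bip A (bip B D)) :=
  in1 \oc (pr1 \oc pr1) + in2 \oc (in1 \oc (pr2 \oc pr1) + in2 \oc pr2).

Fact ext_addC Y X : commutative (@ext_add Y X).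
Proof.
move=> x y; rewrite /ext_add.
have m : ext_push (bip_swap X X) (ext_sum x y) =
         ext_pull (bip_swap Y Y) (ext_sum y x).
  have [c <-] := cls_surj x; have [c' <-] := cls_surj y.
  rewrite !ext_sum_cls; apply: ext_mor; exists (bip_swap _ _).
  by rewrite /= /bip_swap /bip_map !bipE.
have e : codiag X \oc bip_swap X X = codiag X.
  by rewrite /codiag /bip_swap !bipE addrC.
rewrite -[in LHS]e ext_push_comp ext_push_pull m -ext_pull_comp.
have -> // : bip_swap Y Y \oc diag Y = diag Y.
by rewrite /diag /bip_swap !bipE addrC.
Qed.

Fact ext_addA Y X : associative (@ext_add Y X).
Proof.
move=> x y z.
have m : ext_push (bip_assoc X X X) (ext_sum (ext_sum x y) z) =
         ext_pull (bip_assoc Y Y Y) (ext_sum x (ext_sum y z)).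
  have [c <-] := cls_surj x; have [c' <-] := cls_surj y.
  have [c'' <-] := cls_surj z.
  rewrite !ext_sum_cls; apply: ext_mor; exists (bip_assoc _ _ _).
  by rewrite /= /bip_assoc /bip_map !bipE.
have l : ext_add x (ext_add y z) =
    ext_push (codiag X \oc bip_map (idmor X) (codiag X))
      (ext_pull (bip_map (idmor Y) (diag Y) \oc diag Y)
        (ext_sum x (ext_sum y z))).
  rewrite ext_push_comp ext_pull_comp ext_pull_sum ext_push_pull ext_push_sum.
  by rewrite ext_pull1 ext_push1.
have r : ext_add (ext_add x y) z =
    ext_push (codiag X \oc bip_map (codiag X) (idmor X))
      (ext_pull (bip_map (diag Y) (idmor Y) \oc diag Y)
        (ext_sum (ext_sum x y) z)).
  rewrite ext_push_comp ext_pull_comp ext_pull_sum ext_push_pull ext_push_sum.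
  by rewrite ext_pull1 ext_push1.
have eY : bip_map (idmor Y) (diag Y) \oc diag Y =
    bip_assoc Y Y Y \oc (bip_map (diag Y) (idmor Y) \oc diag Y).
  by rewrite /bip_assoc /bip_map /diag !bipE addrA.
have eX : codiag X \oc bip_map (codiag X) (idmor X) =
    codiag X \oc bip_map (idmor X) (codiag X) \oc bip_assoc X X X.
  by rewrite /bip_assoc /bip_map /codiag !bipE addrA.
by rewrite l r eX eY ext_pull_comp -m -ext_push_pull !ext_push_comp.
Qed.

Lemma split_conf Y X : conf (@in1 X Y) pr2.
Proof.
have [A [d cd]] := ex_id_infl X; have [B [i ci]] := ex_id_defl Y.
have d0 : d = 0 by rewrite -[d]compm1 (conf_ker cd).1.
have i0 : i = 0 by rewrite -[i]comp1m (conf_ker ci).1.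
have zA : idmor A = 0.
  by apply: (cokernel_epic (conf_coker cd)); rewrite d0 compm0 comp0m.
have zB : idmor B = 0.
  by apply: (kernel_monic (conf_ker ci)); rewrite i0 compm0 comp0m.
have isoX : is_isom (pr1 : mor (bip X B) X).
  exists in1; split; last exact: pr1in1.
  rewrite -bip_id -[pr2 in RHS]comp1m zB.
  by rewrite comp0m compm0 addr0.
have isoY : is_isom (pr2 : mor (bip A Y) Y).
  exists in2; split; last exact: pr2in2.
  rewrite -bip_id -[pr1 in RHS]comp1m zA.
  by rewrite comp0m compm0 add0r.
apply: (conf_iso isoX (@is_iso_id _) isoY _ _ (conf_bip cd ci)).
  by rewrite /bip_map i0 !bipE.
by rewrite /bip_map d0 !bipE.
Qed.

Definition split_conflation Y X : conflation Y X :=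
  Conflation (@split_conf Y X).
Definition ext_zero Y X : Ext Y X := cls (split_conflation Y X).
Definition ext_opp Y X (x : Ext Y X) : Ext Y X := ext_push (- idmor X) x.
Definition ext_scale Y X (a : k) (x : Ext Y X) : Ext Y X :=
  ext_push (a *: idmor X) x.

Lemma ext_push0 Y X X' (x : Ext Y X) :
  ext_push (0 : mor X X') x = ext_zero Y X'.
Proof.
have [c <-] := cls_surj x; rewrite ext_push_cls; apply/cls_eq/mor_idr.
exists (in2 \oc defl c) => /=; rewrite !bipE; split=> //.
by rewrite (conf_ker (conflationP c)).1 compm0.
Qed.
Lemma ext_pull0 Y Y' X (x : Ext Y X) :
  ext_pull (0 : mor Y' Y) x = ext_zero Y' X.
Proof.
have [c <-] := cls_surj x; rewrite ext_pull_cls; apply/esym/cls_eq/mor_idl.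
exists (infl c \oc pr1) => /=; rewrite !bipE; split=> //.
by rewrite composeA (conf_ker (conflationP c)).1 comp0m.
Qed.

Fact ext_add0 Y X : left_id (ext_zero Y X) (@ext_add Y X).
Proof.
move=> x; rewrite -(@ext_push0 Y X X x) -{2}[x]ext_push1 -ext_push_add add0r.
exact: ext_push1.
Qed.
Fact ext_addN Y X : left_inverse (ext_zero Y X) (@ext_opp Y X) (@ext_add Y X).
Proof.
move=> x; rewrite /ext_opp -{2}[x]ext_push1 -ext_push_add addNr.
exact: ext_push0.
Qed.
HB.instance Definition _ Y X := GRing.isZmodule.Build (Ext Y X)
  (@ext_addA Y X) (@ext_addC Y X) (@ext_add0 Y X) (@ext_addN Y X).

Fact ext_scaleA Y X a b (x : Ext Y X) :
  ext_scale a (ext_scale b x) = ext_scale (a * b) x.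
Proof. by rewrite /ext_scale -ext_push_comp compZl comp1m scalerA. Qed.
Fact ext_scale1 Y X : left_id 1 (@ext_scale Y X).
Proof. by move=> x; rewrite /ext_scale scale1r ext_push1. Qed.
Fact ext_scaleDr Y X : right_distributive (@ext_scale Y X) +%R.
Proof. by move=> a x y; apply: ext_pushD. Qed.
Fact ext_scaleDl Y X x : {morph (@ext_scale Y X)^~ x : a b / a + b}.
Proof. by move=> a b; rewrite /ext_scale scalerDl ext_push_add. Qed.
HB.instance Definition _ Y X := GRing.Zmodule_isLmodule.Build k (Ext Y X)
  (@ext_scaleA Y X) (@ext_scale1 Y X) (@ext_scaleDr Y X) (@ext_scaleDl Y X).

Lemma ext_addE Y X (x y : Ext Y X) : x + y = ext_add x y. Proof. by []. Qed.
Lemma ext_zeroE Y X : (0 : Ext Y X) = ext_zero Y X. Proof. by []. Qed.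

Lemma ext_push_scale Y X X' a (f : mor X X') (x : Ext Y X) :
  ext_push (a *: f) x = a *: ext_push f x.
Proof.
by rewrite -[f in LHS]comp1m -compZl ext_push_comp.
Qed.
Lemma ext_pushZ Y X X' a (f : mor X X') (x : Ext Y X) :
  ext_push f (a *: x) = a *: ext_push f x.
Proof.
by rewrite -ext_push_scale -[f in RHS]compm1 -compZr ext_push_comp.
Qed.

Lemma ext_scale_pull Y X a (x : Ext Y X) : a *: x = ext_pull (a *: idmor Y) x.
Proof.
have [c <-] := cls_surj x; apply: ext_mor; exists (a *: idmor (mid c)).
by rewrite !(compZl, compZr) !(comp1m, compm1).
Qed.
Lemma ext_pullZ Y Y' X a (g : mor Y' Y) (x : Ext Y X) :
  ext_pull g (a *: x) = a *: ext_pull g x.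
Proof. by rewrite /GRing.scale /= /ext_scale ext_push_pull. Qed.
Lemma ext_pull_scale Y Y' X a (g : mor Y' Y) (x : Ext Y X) :
  ext_pull (a *: g) x = a *: ext_pull g x.
Proof. by rewrite -[g in LHS]compm1 -compZr ext_pull_comp -ext_scale_pull. Qed.

Fact ext_push_linear Y X X' (f : mor X X') : linear (@ext_push Y X X' f).
Proof. by move=> a x y; rewrite -ext_pushZ; apply: ext_pushD. Qed.
HB.instance Definition _ Y X X' (f : mor X X') :=
  GRing.isLinear.Build k (Ext Y X) (Ext Y X') *:%R (@ext_push Y X X' f)
    (@ext_push_linear Y X X' f).
Fact ext_pull_linear Y Y' X (g : mor Y' Y) : linear (@ext_pull Y Y' X g).
Proof. by move=> a x y; rewrite -ext_pullZ; apply: ext_pullD. Qed.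
HB.instance Definition _ Y Y' X (g : mor Y' Y) :=
  GRing.isLinear.Build k (Ext Y X) (Ext Y' X) *:%R (@ext_pull Y Y' X g)
    (@ext_pull_linear Y Y' X g).

Definition projectively_trivial X Y (f : mor X Y) : Prop :=
  forall Z (x : Ext Y Z), ext_pull f x = 0.

Definition injectively_trivial X Y (f : mor X Y) : Prop :=
  forall Z (x : Ext Z X), ext_push f x = 0.

Definition inj_trivial_pred X Y : {pred mor X Y} :=
  fun f => `[< injectively_trivial f >].

Fact inj_trivial_closed X Y : GRing.subsemimod_closed (@inj_trivial_pred X Y).
Proof.
split; first split.
- by apply/asboolP=> Z x; rewrite ext_push0.
- move=> f g /asboolP If /asboolP Ig; apply/asboolP=> Z x.
  by rewrite ext_push_add If Ig; apply: addr0.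
move=> a f /asboolP If; apply/asboolP=> Z x.
by rewrite ext_push_scale If scaler0.
Qed.
HB.instance Definition _ X Y := GRing.isSubmodClosed.Build k (mor X Y)
  (@inj_trivial_pred X Y) (@inj_trivial_closed X Y).

Fact inj_trivial_compl X Y Z (g : mor Y Z) (f : mor X Y) :
  f \in @inj_trivial_pred X Y -> g \oc f \in @inj_trivial_pred X Z.
Proof.
move=> /asboolP If; apply/asboolP=> W x.
by rewrite ext_push_comp If linear0.
Qed.
Fact inj_trivial_compr X Y Z (g : mor Y Z) (f : mor X Y) :
  g \in @inj_trivial_pred Y Z -> g \oc f \in @inj_trivial_pred X Z.
Proof.
by move=> /asboolP Ig; apply/asboolP=> W x; rewrite ext_push_comp Ig.
Qed.

Definition inj_ideal : ideal C := Ideal inj_trivial_compl inj_trivial_compr.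

Definition stable_cat : lincat k := quot_cat inj_ideal.

Section DualExt.
Context (E : lmodType k) (X : C).

Definition dext_obj (Z : C) : lmodType k := hom_mod E (Ext X Z).

Fact dext_pre_subproof Z Z' (f : mor Z Z') (phi : dext_obj Z') :
  linear (fun x : Ext X Z => (phi : hom_mod _ _) (ext_push f x)).
Proof. by move=> a x y; rewrite linearP hom_modPl. Qed.

Definition dext_pre Z Z' (f : mor Z Z') (phi : dext_obj Z') : dext_obj Z :=
  mk_hom (dext_pre_subproof f phi).

Lemma dext_preE Z Z' (f : mor Z Z') (phi : dext_obj Z') (x : Ext X Z) :
  (dext_pre f phi : hom_mod _ _) x = (phi : hom_mod _ _) (ext_push f x).
Proof. by []. Qed.

Lemma dext_pre_eq Z Z' (f g : mor Z Z') :
  to_quot inj_ideal f = to_quot inj_ideal g -> dext_pre f = dext_pre g.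
Proof.
move=> /quot_pi_eq /asboolP I; apply/funext=> phi; apply: hom_modP => x.
by rewrite !dext_preE -[f](subrK g) ext_push_add I; congr hom_mod_apply;
  apply: add0r.
Qed.

Definition dext_map (Z Z' : stable_cat) (u : mor Z Z') :
    dext_obj Z' -> dext_obj Z := @dext_pre Z Z' (repr u).

Lemma dext_mapE Z Z' (f : mor Z Z') :
  dext_map (to_quot inj_ideal f) = dext_pre f.
Proof. by apply: dext_pre_eq; apply: reprK. Qed.

Fact dext_map_linear Z Z' (u : @mor k stable_cat Z Z') : linear (dext_map u).
Proof. by move=> a phi psi; apply: hom_modP. Qed.
HB.instance Definition _ Z Z' (u : @mor k stable_cat Z Z') :=
  GRing.isLinear.Build k (dext_obj Z') (dext_obj Z) *:%R (dext_map u)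
    (dext_map_linear u).

Fact dext_map1 (Z : stable_cat) (phi : dext_obj Z) :
  dext_map (idmor Z) phi = phi.
Proof.
rewrite (dext_mapE (idmor (Z : C))); apply: hom_modP => x.
by rewrite dext_preE ext_push1.
Qed.
Fact dext_mapM (X1 X2 X3 : stable_cat) (v : mor X2 X3) (u : mor X1 X2)
  (phi : dext_obj X3) : dext_map (v \oc u) phi = dext_map u (dext_map v phi).
Proof.
have [g <-] := quot_pi_surj v; have [f <-] := quot_pi_surj u.
have -> : (quot_pi _ g : mor (X2 : stable_cat) X3) \oc quot_pi _ f =
  to_quot inj_ideal (g \oc f) by apply: quot_compE.
rewrite (dext_mapE g) (dext_mapE f) dext_mapE; apply: hom_modP => x.
by rewrite !dext_preE ext_push_comp.
Qed.
Fact dext_mapP (X1 X2 : stable_cat) a (u v : mor X1 X2) (phi : dext_obj X2) :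
  dext_map (a *: u + v) phi = a *: dext_map u phi + dext_map v phi.
Proof.
have [f <-] := quot_pi_surj u; have [g <-] := quot_pi_surj v.
rewrite -linearP (dext_mapE f) (dext_mapE g) (dext_mapE (a *: f + g)).
apply: hom_modP => x.
rewrite dext_preE ext_push_add ext_push_scale.
exact: (hom_modPl phi a (ext_push f x) (ext_push g x)).
Qed.

(* D Ext^1(X, -) on C / I, where D = Hom_k(-, E): contravariant, since D is. *)
Definition dext : cofunctor stable_cat :=
  @Cofunctor k stable_cat dext_obj (fun Z Z' u => dext_map u)
    dext_map1 dext_mapM dext_mapP.

Definition in_Cr : Prop := representable dext.

(* tau X is determined only up to isomorphism in C / I, hence a predicate. *)
Definition is_tau (T : C) : Prop := represents dext T.

End DualExt.

End ExactTheory.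

Arguments in1 {k C A B}.
Arguments in2 {k C A B}.
Arguments pr1 {k C A B}.
Arguments pr2 {k C A B}.

(* Main.v *)
(** Let [e] in [D Ext(C, tau C)] be the universal element given by Yoneda. The
    pairing [(h, x) |-> e (h^* x)] of [Hom(C, T)] with [Ext(T, tau C)] has no
    kernel on the right, and every functional on [Hom(C, Y)] that kills the
    projectively trivial morphisms is [e (-^* x)] for some [x]; this is the half
    of Auslander-Reiten duality that is needed. A morphism [f : C -> Y] outside
    [H] is separated from [H] by a functional [e (-^* x)], and then [f^* x <> 0]
    whereas [h^* x = 0] for [h] in [H], since [H] is stable under [End C]. By the
    descending chain condition finitely many such [x] suffice: together they
    form one class in [Ext(Y, (tau C)^n)], and [alpha] is its deflation. *)
Require Import Defs.
From HB Require Import structures.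
From mathcomp Require Import all_boot all_algebra.
From mathcomp Require Import boolp.

Set Implicit Arguments.
Unset Strict Implicit.
Unset Printing Implicit Defensive.

Import GRing.Theory.
Local Open Scope ring_scope.
Local Open Scope cat_scope.

(** * Chain conditions, injective modules and cogenerators *)

Section Modules.
Context (R : pzRingType).

Section PropSubmodule.
Context (M : lmodType R) (P : M -> Prop) (P0 : P 0).
Context (PD : forall a x y, P x -> P y -> P (a *: x + y)).

Fact prop_submod_closed :
  GRing.subsemimod_closed ((fun x => `[< P x >]) : {pred M}).
Proof.
split; first split.
- exact/asboolP.
- by move=> x y /asboolP Px /asboolP Py; apply/asboolP;
    rewrite -[x]scale1r; apply: PD.
by move=> a x /asboolP Px; apply/asboolP; rewrite -[_ *: _]addr0; apply: PD.
Qed.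

Definition prop_submod : submodClosed M :=
  HB.pack_for (submodClosed M) ((fun x => `[< P x >]) : {pred M})
    (GRing.isSubmodClosed.Build R M _ prop_submod_closed).

Lemma prop_submodE x : x \in prop_submod <-> P x.
Proof. by split=> /asboolP. Qed.

End PropSubmodule.

(** Induction on the number of vectors, which need not generate [M]: splitting off the first one
    leaves a shorter span and a chain of left ideals. *)
Lemma artinian_span_chain (M : lmodType R) (S : nat -> submodClosed M) n
    (v : 'I_n -> M) :
  artinian R -> (forall j, {subset S j.+1 <= S j}) ->
  exists N, forall m, (N <= m)%N -> forall a : 'I_n -> R,
    \sum_i a i *: v i \in S N -> \sum_i a i *: v i \in S m.
Proof.
move=> artR desc.
have mono i j : (i <= j)%N -> {subset S j <= S i}.
  elim: j => [|j IH]; first by rewrite leqn0 => /eqP ->.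
  by rewrite leq_eqVlt => /orP[/eqP -> //|/IH sij x /desc /sij].
elim: n v => [|n IH] v; first by exists 0 => m _ a; rewrite !big_ord0 !rpred0.
pose w i := v (lift ord0 i).
(* Coefficients at [v ord0] of the combinations lying in [S j]: a left ideal of [R], descending in
   [j]. *)
pose L j (a : R) := exists b : 'I_n -> R,
  a *: v ord0 + \sum_i b i *: w i \in S j.
have L0 j : L j 0.
  exists (fun=> 0); rewrite scale0r add0r big1 ?rpred0 // => i _.
  exact: scale0r.
have LD j a x y : L j x -> L j y -> L j (a * x + y).
  move=> [b bS] [c cS]; exists (fun i => a * b i + c i).
  have -> : \sum_i (a * b i + c i) *: w i =
      a *: \sum_i b i *: w i + \sum_i c i *: w i.
    rewrite scaler_sumr -big_split; apply: eq_bigr => i _ /=.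
    by rewrite scalerDl scalerA.
  have -> : (a * x + y) *: v ord0 = a *: (x *: v ord0) + y *: v ord0.
    by rewrite scalerDl scalerA.
  by rewrite addrACA -scalerDr rpredD ?rpredZ.
pose I j : submodClosed R^o := @prop_submod R^o (L j) (L0 j) (@LD j).
have IE j x : x \in I j <-> L j x by apply: prop_submodE.
have [N1 st1] : exists N, forall m, (N <= m)%N -> I m =i I N.
  by apply: artR => j a /IE[b bS]; apply/IE; exists b; apply: desc.
have [N2 st2] := IH w.
exists (maxn N1 N2) => m; rewrite geq_max => /andP[le1 le2] a.
rewrite !big_ord_recl => aS.
(* Some element of [S m] has the same coefficient at [v ord0]; the difference lies in the span of
   [w], where induction applies. *)
have [b bS] : L m (a ord0).
  apply/IE; rewrite st1 //; apply/IE.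
  by exists (fun i => a (lift ord0 i)); apply: mono aS; apply: leq_maxl.
rewrite -[X in X \in _](subrK (a ord0 *: v ord0 + \sum_i b i *: w i)).
apply: rpredD => //; rewrite opprD addrACA subrr add0r.
have e : \sum_i a (lift ord0 i) *: w i - \sum_i b i *: w i =
   \sum_i (a (lift ord0 i) - b i) *: w i.
  by rewrite -sumrB; apply: eq_bigr => i _; rewrite scalerBl.
rewrite e; apply: st2 => //; rewrite -e.
have -> : \sum_i a (lift ord0 i) *: w i - \sum_i b i *: w i =
   (a ord0 *: v ord0 + \sum_i a (lift ord0 i) *: w i)
   - (a ord0 *: v ord0 + \sum_i b i *: w i).
  by rewrite opprD addrACA subrr add0r.
rewrite -scaleN1r; apply: rpredD; last by apply/rpredZ/(mono _ _ le2).
by apply: mono aS; apply: leq_maxr.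
Qed.

Lemma artinian_chain (M : lmodType R) (S : nat -> submodClosed M) :
  artinian R -> finitely_generated M ->
  (forall j, {subset S j.+1 <= S j}) ->
  exists N, forall m, (N <= m)%N -> {subset S N <= S m}.
Proof.
move=> artR [n [v gen]] desc.
have [N st] := artinian_span_chain v artR desc.
by exists N => m le x; have [a ->] := gen x; apply: st.
Qed.

Section QuotientLift.
Context (M N : lmodType R) (S : submodClosed M) (f : {linear M -> N}).
Context (fS : {in S, forall x, f x = 0}).

Definition quot_lift (u : quot_mod S) : N := f (repr u).

Lemma quot_liftE x : quot_lift (quot_pi S x) = f x.
Proof.
apply/eqP; rewrite -subr_eq0 /quot_lift -linearB fS //.
by apply/quot_pi_eq; rewrite {1}/quot_pi reprK.
Qed.

Fact quot_lift_linear : linear quot_lift.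
Proof.
move=> a u v; have [x <-] := quot_pi_surj u; have [y <-] := quot_pi_surj v.
by rewrite -linearP !quot_liftE linearP.
Qed.

Definition quot_lift_hom : {linear quot_mod S -> N} :=
  HB.pack_for {linear quot_mod S -> N} quot_lift
    (GRing.isLinear.Build R (quot_mod S) N *:%R quot_lift quot_lift_linear).

End QuotientLift.

(** Both maps descend to the quotient by the kernel of [i], where [i] becomes injective. *)
Lemma injective_module_factor (E M N : lmodType R) (i : {linear M -> N})
    (f : {linear M -> E}) :
  injective_module E -> (forall x, i x = 0 -> f x = 0) ->
  exists g : {linear N -> E}, forall x, g (i x) = f x.
Proof.
move=> injE fi.
have K0 : i 0 = 0 by apply: linear0.
have KD a x y : i x = 0 -> i y = 0 -> i (a *: x + y) = 0.
  by move=> ix iy; rewrite linearP ix iy scaler0 addr0.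
pose K := prop_submod K0 KD.
have iK : {in K, forall x, i x = 0} by move=> x /prop_submodE.
have fK : {in K, forall x, f x = 0} by move=> x /iK /fi.
have [|g gE] := injE _ _ (quot_lift_hom iK) (quot_lift_hom fK).
  move=> u v; have [x <-] := quot_pi_surj u; have [y <-] := quot_pi_surj v.
  rewrite /= !quot_liftE // => e; apply/quot_pi_eq/prop_submodE.
  by rewrite linearB e subrr.
exists g => x; have := gE (quot_pi K x).
by rewrite /= !quot_liftE.
Qed.

(** The class of [x] in the quotient by [S] is nonzero, and a functional on the quotient pulls back
    to [M]. *)
Lemma cogenerator_separates (E M : lmodType R) (S : submodClosed M) x :
  cogenerator E -> x \notin S ->
  exists2 f : {linear M -> E}, {in S, forall y, f y = 0} & f x != 0.
Proof.
move=> cogE xS; have [|f fx] := cogE (quot_mod S) (quot_pi S x).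
  apply: contra xS => /eqP e; rewrite -[x]subr0; apply/quot_pi_eq.
  by rewrite e linear0.
exists (f \o quot_pi S)%FUN => // y yS /=.
have -> : quot_pi S y = quot_pi S 0 by apply/quot_pi_eq; rewrite subr0.
by rewrite !linear0.
Qed.

End Modules.

Lemma hom_mod0 (k : comPzRingType) (E M : lmodType k) (phi : hom_mod E M) :
  phi 0 = 0.
Proof. exact: (linear0 (hom_fun phi)). Qed.

(** * Extension classes and their annihilators *)

Section Exact.
Context (k : comPzRingType) (CC : exact_cat k).
Implicit Types A B K T W X Y Z : CC.

(** A section of the pulled back deflation, followed by the projection to [mid c], is a lift of [g];
    conversely a lift splits the pullback. *)
Lemma ext_pull_eq0 X Y T (c : conflation Y X) (g : mor T Y) :
  ext_pull g (cls c) = 0 <-> exists t, g = defl c \oc t.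
Proof.
rewrite ext_pull_cls; split=> [/esym/cls_eq[u [/= _ du]]|[t ->]].
  have [h [pb _]] := pullP g c; exists (h \oc u \oc in2).
  rewrite !composeA pb.1 -2!composeA [_ \oc (u \oc _)]composeA du pr2in2.
  by rewrite compm1.
apply/esym/cls_eq/mor_idl; exists (infl c \oc pr1 + t \oc pr2) => /=.
rewrite !bipE; split=> //.
by rewrite composeA (conf_ker (conflationP c)).1 comp0m add0r.
Qed.

Lemma ext_push_infl X Y (c : conflation Y X) : ext_push (infl c) (cls c) = 0.
Proof.
rewrite ext_push_cls; apply/cls_eq/mor_idr.
exists (in1 + in2 \oc defl c) => /=; rewrite !bipE; split=> //.
by rewrite (conf_ker (conflationP c)).1 compm0 addr0.
Qed.

(** Exactness of [Hom(W, Y) -> Ext(W, X) -> Ext(W, mid c)] in the middle. *)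
Lemma ext_push_infl_eq0 X Y W (c : conflation Y X) (y : Ext W X) :
  ext_push (infl c) y = 0 -> exists h : mor W Y, ext_pull h (cls c) = y.
Proof.
have [b <-] := cls_surj y; rewrite ext_push_cls => /cls_eq[u [/= ui _]].
have [q [[qj _] _]] := pushP (infl c) b.
(* [pr1 \oc u] retracts the split pushout onto [mid c], so [r] extends [infl c] to [mid b] and
   induces [h] on cokernels. *)
pose r := pr1 \oc u \oc q.
have rj : r \oc infl b = infl c.
  rewrite /r -composeA qj composeA -[pr1 \oc u \oc _]composeA ui pr1in1.
  exact: comp1m.
have [|h [hp _]] := (conf_coker (conflationP b)).2 _ (defl c \oc r).
  by rewrite -composeA rj (conf_ker (conflationP c)).1.
exists h; rewrite ext_pull_cls; apply/esym/cls_eq/mor_idl.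
by exists r; rewrite rj compm1.
Qed.

Lemma ext_pushB X Z Y (f g : mor X Z) (x : Ext Y X) :
  ext_push (f - g) x = ext_push f x - ext_push g x.
Proof. by rewrite ext_push_add -scaleN1r ext_push_scale scaleN1r. Qed.

(** The class with components [x] and [y] under the additivity of [Ext(Y, -)]. *)
Definition bip_ext Y Z W (x : Ext Y Z) (y : Ext Y W) : Ext Y (bip Z W) :=
  ext_push in1 x + ext_push in2 y.

Lemma ext_pull_bip_eq0 T Y Z W (f : mor T Y) (x : Ext Y Z) (y : Ext Y W) :
  ext_pull f (bip_ext x y) = 0 <-> ext_pull f x = 0 /\ ext_pull f y = 0.
Proof.
rewrite linearD /= -!ext_push_pull; split=> [e|[-> ->]]; last first.
  by rewrite !linear0 addr0.
have e1 := congr1 (ext_push pr1) e; have e2 := congr1 (ext_push pr2) e.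
move: e1 e2; rewrite !linearD !linear0 /= -!ext_push_comp.
rewrite pr1in1 pr1in2 pr2in1 pr2in2 !ext_push1 !ext_push0 -!ext_zeroE.
by rewrite addr0 add0r.
Qed.

(* By the descending chain condition, taking direct sums of conflations with
   smaller and smaller annihilators stops at the prescribed one. *)
Lemma annihilator_exists X Y (S : mor X Y -> Prop) (Q : CC -> Prop) Z0 :
  artinian k -> finitely_generated (mor X Y) ->
  Q Z0 -> (forall Z W, Q Z -> Q W -> Q (bip Z W)) ->
  (forall f, ~ S f -> exists Z (x : Ext Y Z),
     [/\ Q Z, forall g, S g -> ext_pull g x = 0 & ext_pull f x <> 0]) ->
  exists Z (x : Ext Y Z), Q Z /\ forall f, S f <-> ext_pull f x = 0.
Proof.
move=> artk fgXY QZ0 Qbip sep; apply: contrapT => none.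
pose good (u : {Z : CC & Ext Y Z}) :=
  Q (tag u) /\ forall g, S g -> ext_pull g (tagged u) = 0.
(* By [none], the annihilator of a good [u] contains some [f] outside [S]; adjoining a class that
   separates [f] from [S] shrinks it strictly. *)
have next (u : {u | good u}) : exists v : {u | good u},
    (forall f : mor X Y, ext_pull f (tagged (sval v)) = 0 ->
       ext_pull f (tagged (sval u)) = 0) /\
    exists2 f : mor X Y, ext_pull f (tagged (sval u)) = 0 &
       ext_pull f (tagged (sval v)) <> 0.
  case: u => -[Z x] [/= QZ Sx].
  have [f fx nSf] : exists2 f : mor X Y, ext_pull f x = 0 & ~ S f.
    apply: contrapT => nf; apply: none; exists Z, x; split=> // f.
    by split=> [/Sx //|fx]; apply: contrapT => nSf; apply: nf; exists f.
  have [W [y [QW Sy fy]]] := sep f nSf.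
  have gv : good (existT _ (bip Z W) (bip_ext x y)).
    split=> [|g Sg] /=; first exact: Qbip.
    by apply/ext_pull_bip_eq0; split; [apply: Sx|apply: Sy].
  exists (exist _ _ gv) => /=; split=> [g /ext_pull_bip_eq0[]//|].
  by exists f => // /ext_pull_bip_eq0[].
(* The chain starts at the zero class, annihilated by all of [mor X Y]. *)
have g0 : good (existT _ Z0 (0 : Ext Y Z0)) by split=> //= g _; rewrite linear0.
pose u := fix u n : {u | good u} :=
  if n is m.+1 then sval (cid (next (u m))) else exist _ _ g0.
pose I n (f : mor X Y) := ext_pull f (tagged (sval (u n))) = 0.
have I0 n : I n 0 by apply: ext_pull0.
have ID n a f g : I n f -> I n g -> I n (a *: f + g).
  move=> If Ig; rewrite /I ext_pull_add ext_pull_scale If Ig scaler0.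
  exact: add0r.
have [|N stN] := artinian_chain
    (S := fun n => prop_submod (I0 n) (@ID n)) artk fgXY.
  move=> n f /prop_submodE fI; apply/prop_submodE; move: fI.
  exact: (svalP (cid (next (u n)))).1.
have [f fN fN1] := (svalP (cid (next (u N)))).2; apply: fN1.
apply/(prop_submodE (I0 N.+1) (@ID N.+1))/(stN N.+1 (leqnSn N)).
exact/prop_submodE.
Qed.

Lemma direct_sum_bip (M : CC) m n Z W :
  is_direct_sum (fun _ : 'I_m => M) Z -> is_direct_sum (fun _ : 'I_n => M) W ->
  is_direct_sum (fun _ : 'I_(m + n) => M) (bip Z W).
Proof.
move=> [i [p [pi1 pi0 sip]]] [j [q [qj1 qj0 sjq]]].
exists (fun a => match split a with
  | inl b => in1 \oc i b | inr b => in2 \oc j b end).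
exists (fun a => match split a with
  | inl b => p b \oc pr1 | inr b => q b \oc pr2 end).
split=> [a|a b|].
- by case: (split a) => c; rewrite !bipE ?pi1 ?qj1.
- rewrite -(inj_eq (can_inj (@splitK m n))).
  case: (split a) (split b) => [a'|a'] [b'|b'] /= ne; rewrite !bipE //.
    by apply: pi0; apply: contraNneq ne => ->.
  by apply: qj0; apply: contraNneq ne => ->.
have suml n' A B (M' : 'I_n' -> mor M A) (P : 'I_n' -> mor A M) (i0 : mor A B)
    (p0 : mor B A) :
    \sum_l (i0 \oc M' l \oc (P l \oc p0)) =
    i0 \oc (\sum_l (M' l \oc P l)) \oc p0.
  rewrite (big_morph (compose i0) (compDr i0) (compm0 _ i0)).
  rewrite (big_morph (fun g => g \oc p0)
    (fun g g' => compDl g g' p0) (comp0m _ p0)).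
  by apply: eq_bigr => l _; rewrite !composeA.
rewrite big_split_ord -bip_id /=; congr (_ + _).
  rewrite -[in RHS](compm1 in1) -sip -suml; apply: eq_bigr => l _.
  by rewrite (unsplitK (inl l)).
rewrite -[in RHS](compm1 in2) -sjq -suml; apply: eq_bigr => l _.
by rewrite (unsplitK (inr l)).
Qed.

(** [x] is the sum of its images under the idempotents [i j \oc p j], each of which factors through
    a summand. *)
Lemma ext_direct_sum_eq0 n (A : 'I_n -> CC) S Y (x : Ext Y S) :
  is_direct_sum A S ->
  (forall j (p : mor S (A j)), ext_push p x = 0) -> x = 0.
Proof.
move=> [i [p [_ _ ip]]] px; rewrite -[LHS]ext_push1 -ip.
have push0 : ext_push (0 : mor S S) x = 0 by apply: ext_push0.
have pushD f g : ext_push (f + g) x = ext_push f x + ext_push (g : mor S S) x.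
  exact: ext_push_add.
rewrite (big_morph _ pushD push0) big1 // => j _.
by rewrite ext_push_comp px linear0.
Qed.

(** * Auslander-Reiten duality between [D] and its translate [K] *)

Section AuslanderReiten.
Context (kv : lmodType k) (kv_inj : injective_module kv).
Context (D K : CC) (DK : is_tau kv D K).

(* [e] is the universal element of [D Ext(D, K)], given by Yoneda. *)
Lemma tau_universal : exists e : hom_mod kv (Ext D K),
  (forall Z (psi : hom_mod kv (Ext D Z)), exists u : mor Z K,
     forall x, psi x = e (ext_push u x)) /\
  (forall Z (u : mor Z K), (forall x : Ext D Z, e (ext_push u x) = 0) ->
     injectively_trivial u).
Proof.
have [phi [bij nat]] := DK.
pose J := inj_ideal CC.
pose e := phi K (to_quot J (idmor K)).
have phiE Z (u : mor Z K) : phi Z (to_quot J u) = dext_pre u e.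
  rewrite -dext_mapE -nat; congr (phi Z _); symmetry.
  by rewrite /= /to_quot quot_compE comp1m.
exists e; split=> [Z psi|Z u eu].
  have [phi' _ phiK] := bij Z; have [u uE] := quot_pi_surj (phi' psi).
  exists u => x; rewrite -dext_preE -phiE; congr (hom_mod_apply _ x).
  by rewrite -[LHS]phiK -uE.
have /quot_pi_eq/asboolP : to_quot J u = to_quot J 0.
  apply: (bij_inj (bij Z)); rewrite !phiE; apply: hom_modP => x.
  by rewrite !dext_preE eu ext_push0 -ext_zeroE; apply/esym/hom_mod0.
by rewrite subr0.
Qed.

Context (e : hom_mod kv (Ext D K)).
Context (e_repr : forall Z (psi : hom_mod kv (Ext D Z)), exists u : mor Z K,
  forall x, psi x = e (ext_push u x)).
Context (e_inj : forall Z (u : mor Z K),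
  (forall x : Ext D Z, e (ext_push u x) = 0) -> injectively_trivial u).

(* Writing [x] as [K -i-> E -> T], [e] vanishes on the image of the connecting
   map [Hom(D, T) -> Ext(D, K)], the kernel of [i_*]. So it extends along [i_*],
   to [e (u_* -)] say; then [u i - 1] is injectively trivial and
   [x = u_* i_* x = 0]. *)
Lemma tau_nondegenerate T (x : Ext T K) :
  (forall h : mor D T, e (ext_pull h x) = 0) -> x = 0.
Proof.
have [c <-] := cls_surj x => eh.
have [|psi psiE] := injective_module_factor (i := ext_push (infl c))
    (f := hom_fun e) kv_inj.
  by move=> y /ext_push_infl_eq0 [h <-]; apply: eh.
have [u uE] := e_repr (HomMod psi).
have : injectively_trivial (u \oc infl c - idmor K).
  apply: e_inj => y; rewrite ext_pushB ext_push1 ext_push_comp.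
  rewrite [LHS](linearB (hom_fun e)); apply/eqP; rewrite subr_eq0; apply/eqP.
  by rewrite -[LHS]uE; apply: psiE.
move=> /(_ _ (cls c)); rewrite ext_pushB ext_push_comp ext_push_infl.
by rewrite linear0 ext_push1 sub0r => /eqP; rewrite oppr_eq0 => /eqP.
Qed.

(** A single class [x] has exactly the projectively trivial morphisms as annihilator. So [l] factors
    through [f |-> f^* x], and by injectivity of [kv] through a functional on [Ext(D, Z)]. That
    functional is [e (u_* -)], and [u_* x] represents [l]. *)
Lemma tau_functional Y (l : {linear mor D Y -> kv}) :
  artinian k -> finitely_generated (mor D Y) ->
  (forall f, projectively_trivial f -> l f = 0) ->
  exists x : Ext Y K, forall f, e (ext_pull f x) = l f.
Proof.
move=> artk fgDY lP.
(* The coefficient object is unconstrained here, so [Y] is an arbitrary starting point. *)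
have [|Z [x [_ Px]]] := annihilator_exists (S := @projectively_trivial k CC D Y)
    (Q := fun=> True) (Z0 := Y) artk fgDY I (fun _ _ _ _ => I).
  move=> f /existsNP[Z /existsNP[x fx]]; exists Z, x; split=> // g; exact.
have pull_lin : linear (fun f : mor D Y => ext_pull f x).
  by move=> a f g; rewrite ext_pull_add ext_pull_scale.
pose pullx : {linear mor D Y -> Ext D Z} := HB.pack_for
  {linear mor D Y -> Ext D Z} (fun f : mor D Y => ext_pull f x)
  (GRing.isLinear.Build k (mor D Y) (Ext D Z) *:%R _ pull_lin).
have [|psi psiE] := injective_module_factor (i := pullx) (f := l) kv_inj.
  by move=> f /Px /lP.
have [u uE] := e_repr (HomMod psi).
exists (ext_push u x) => f; rewrite -ext_push_pull -uE; exact: psiE.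
Qed.

End AuslanderReiten.

End Exact.


Theorem theorem4p3 (k : comPzRingType) (k_artinian : artinian k)
    (kv : lmodType k) (kv_cogen : minimal_injective_cogenerator kv)
    (CC : exact_cat k) (CC_hom_finite : hom_finite CC)
    (CC_krull_schmidt : krull_schmidt CC)
    (C Y : CC) (C_in_Cr : in_Cr kv C)
    (tauC : CC) (tauC_is_tau : is_tau kv C tauC)
    (H : submodClosed (hom_from C Y))
    (P_sub_H : forall f : mor C Y, projectively_trivial f -> f \in H) :
  exists (X : CC) (alpha : mor X Y),
    [/\ deflation alpha,
        right_determined C alpha,
        exists (K : CC) (i : mor K X), is_kernel i alpha /\ in_add tauC K
      & forall f : mor C Y,
          f \in H <-> exists s : mor C X, f = alpha \oc s].
Proof.
have [kv_inj kv_cog _] := kv_cogen.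
have [e [e_repr e_inj]] := tau_universal tauC_is_tau.
(* Scalars of [k] act through multiples of [idmor C], so the [Gamma C]-submodule [H] is also a
   [k]-submodule. *)
have HZ a (f g : mor C Y) : f \in H -> g \in H -> a *: f + g \in H.
  move=> Hf Hg; apply: (rpredD (S := H)) => //.
  have := rpredZ (a *: idmor C : Gamma C) Hf.
  by rewrite /GRing.scale /= /gamma_scale compZr compm1.
pose Hk : submodClosed (mor C Y) := prop_submod (rpred0 H) HZ.
pose Q Z := exists n, is_direct_sum (fun _ : 'I_n => tauC) Z.
have Q1 : Q tauC.
  exists 1, (fun=> idmor tauC), (fun=> idmor tauC).
  split=> [_|j l|]; rewrite ?big_ord1 ?comp1m //.
  by rewrite !ord1 eqxx.
have Qbip Z W : Q Z -> Q W -> Q (bip Z W).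
  by move=> [m dm] [n dn]; exists (m + n)%N; apply: direct_sum_bip.
have [|K [x [[n QK] Hx]]] := annihilator_exists (S := fun f : mor C Y => f \in H)
    k_artinian (CC_hom_finite C Y) Q1 Qbip.
  move=> f nHf.
  have [|l lH lf] := cogenerator_separates (S := Hk) (x := f) kv_cog.
    by apply/negP => /prop_submodE.
  have [|y yE] := tau_functional kv_inj e_repr (l := l) k_artinian
      (CC_hom_finite C Y).
    by move=> g /P_sub_H Hg; apply: lH; apply/prop_submodE.
  exists tauC, y; split=> // [g Hg|fy].
    (* Here [e (h^* g^* y) = l (g \oc h)], and [g \oc h] stays in [H]. *)
    apply: (tau_nondegenerate kv_inj e_repr e_inj) => h.
    rewrite -ext_pull_comp yE; apply: lH; apply/prop_submodE.
    exact: (rpredZ (h : Gamma C) Hg).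
  by move: lf; rewrite -yE fy hom_mod0 eqxx.
have [c cx] := cls_surj x; subst x.
exists (mid c), (defl c); split.
- by exists K, (infl c); apply: conflationP.
(* [g] lifts once [g^*] kills [cls c]. The images of this pullback in [Ext(T, tauC)] are tested by
   [e] along all [h : C -> T], and each [g \oc h] lifts by assumption. *)
- move=> T g gh; apply/ext_pull_eq0.
  apply: (ext_direct_sum_eq0 QK) => _ p.
  apply: (tau_nondegenerate kv_inj e_repr e_inj) => h.
  rewrite -ext_push_pull -ext_pull_comp.
  have [s gs] := gh h; have -> : ext_pull (g \oc h) (cls c) = 0.
    by apply/ext_pull_eq0; exists s.
  by rewrite linear0 hom_mod0.
- exists K, (infl c); split; first exact: conf_ker (conflationP c).
  (* [K] is itself a finite direct sum of copies of [tauC]; the complement is a zero object. *)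
  exists n, K; split=> //.
  have [Z0 [Z0t Z0f]] := ex_zero CC.
  exists Z0, (idmor K), 0, (idmor K), 0.
  by split; rewrite ?comp1m ?compm0 ?addr0 ?comp0m //; rewrite Z0t.
- by move=> f; apply: iff_trans (Hx f) (ext_pull_eq0 _ _).
Qed.
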